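(* Let $\Phi$ be a rectified derivation in $\mathsf{MLS1^X}$ from $\mathsf t$ to a formula $A$ in which $\mathsf f$ does not occur. Then $\mathcal F(\Phi)=\langle\mathcal G(A),\sim_\Phi\rangle$ is a fonet and $\delta_\Phi$ is a dualizer for it.
   Context: Formulas: terms $t::=x\mid f(t_1,\dots,t_n)$; atoms $a::=\mathsf t\mid\mathsf f\mid p(\vec t)\mid\bar p(\vec t)$ (each predicate $p$ has a dual $\bar p$, $\bar{\bar p}=p$); formulas $A::=a\mid A\wedge A\mid A\vee A\mid\exists x.A\mid\forall x.A$ with $\overline{p(\vec t)}=\bar p(\vec t)$, $\bar{\mathsf t}=\mathsf f$. A formula is rectified if all bound variables are distinct from each other and from free variables. $\equiv$ is the smallest congruence with $\wedge,\vee$ commutative and associative, $\forall x\forall y.A\equiv\forall y\forall x.A$, $\exists x\exists y.A\equiv\exists y\exists x.A$, $\forall x.(A\vee B)\equiv(\forall x.A)\vee B$, $\exists x.(A\wedge B)\equiv(\exists x.A)\wedge B$ ($x$ not free in $B$). A context $S\{\ \}$ is a formula with one hole in place of an atom; a derivation from $B$ to $A$ is a sequence of formulas from $B$ to $A$, each step a rule instance. $\mathsf{MLS1^X}$ rules (premise $\Rightarrow$ conclusion in any context): $\forall$: $S\{\mathsf t\}\Rightarrow S\{\forall x.\mathsf t\}$; $\mathsf{ai}$: $S\{\mathsf t\}\Rightarrow S\{a\vee\bar a\}$; $\mathsf t$-rule: $S\{A\}\Rightarrow S\{A\wedge\mathsf t\}$; $\mathsf s$: $S\{A\wedge(B\vee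 C)\}\Rightarrow S\{(A\wedge B)\vee C\}$; $\mathsf{mix}$: $S\{A\wedge B\}\Rightarrow S\{A\vee B\}$; $\exists$: $S\{A[x/t]\}\Rightarrow S\{\exists x.A\}$; $\equiv$: $S\{B\}\Rightarrow S\{A\}$ if $A\equiv B$. A derivation is rectified if its conclusion is rectified (then every line is). For rectified $\Phi$: $\delta_\Phi$ maps each existentially bound variable $x$ of $A$ to the term $t$ substituted for it in the $\exists$ instance introducing $\exists x$; tracing atom occurrences upward through $\Phi$, each atom occurrence of $A$ other than $\mathsf t$ is consumed by a unique $\mathsf{ai}$ instance, and $\sim_\Phi$ relates two atom occurrences iff they are consumed by the same $\mathsf{ai}$ instance. $\mathcal G(a)$ is one vertex labelled $a$, $\mathcal G(A\vee B)=\mathcal G(A)+\mathcal G(B)$ (disjoint union), $\mathcal G(A\wedge B)=\mathcal G(A)\times\mathcal G(B)$ (disjoint union plus all edges between the parts), $\mathcal G(\exists x.A)=\bullet_x\times\mathcal G(A)$, $\mathcal G(\forall x.A)=\bullet_x+\mathcal G(A)$ ($\bullet_x$ one vertex labelled $x$); vertices correspond to atom and quantifier occurrences. Fograph notions: a module is a vertex set $M$ with $N(v)\setminus M=N(w)\setminus M$ for $v,w\in M$; strong if every module contains it, is contained in it or is disjoint from it; proper if $|M|\ge2$. Atom-labelled vertices are literals, $x$-labelled vertices are $x$-binders. The scope of a binder is the smallest proper strong module containing it; an $x$-binder binds every literal in its scope whose atom contains $x$; a binder is existential (universal) if adjacent (non-adjacent) to all other vertices of its scope. Two atoms are pre-dual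 if neither is $\mathsf t,\mathsf f$ and their predicate symbols are $p$ and $\bar p$. A linked fograph is a fograph with a partial equivalence relation whose classes (links) are pairs of pre-dual literals, every literal labelled $\mathsf t$ or in a link. A dualizer is a substitution $\delta$ with $\ell(w)\delta=\overline{\ell(v)\delta}$ for each link $\{v,w\}$. A dependency is a pair of an existential $x$-binder and a universal $y$-binder such that the most general dualizer maps $x$ to a term containing $y$. The leap graph has edges the links and dependencies. A nonempty vertex set $W$ induces a matching if each $w\in W$ has exactly one neighbour in $W$; a bimatching if it induces a matching in both the fograph and the leap graph. A fonet is a linked fograph with a dualizer and no induced bimatching.
   Formalization: δ_Φ is taken as the composition of the ∃-instance substitutions (x maps to t with variables of t instantiated further up also replaced), since the bare map x↦t need not be a dualizer; ''rectified'' is taken to mean that every line of Φ is rectified. *)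

(* Defs.v *)
From mathcomp Require Import all_boot.

Set Implicit Arguments.
Unset Strict Implicit.
Unset Printing Implicit Defensive.

Record signature := Signature {
  funsym : eqType; funar : funsym -> nat;
  predsym : eqType; predar : predsym -> nat }.

Notation var := nat (only parsing).

Inductive term (Sg : signature) :=
| Var of var
| Fn (f : funsym Sg) (ts : {ffun 'I_(funar f) -> term Sg}).
Arguments Var {Sg} x.
Arguments Fn {Sg} f ts.

(* The generated scheme gives no hypothesis on the arguments of [Fn]. *)
Lemma term_induction Sg (P : term Sg -> Prop) :
  (forall x, P (Var x)) ->
  (forall (f : funsym Sg) (ts : {ffun 'I_(funar f) -> term Sg}), (forall i, P (ts i)) -> P (Fn f ts)) ->
  forall t, P t.
Proof.
by move=> PV PF; fix IHt 1 => -[x|f ts]; [apply: PV | apply: PF => i; apply: IHt].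
Qed.

(* [Pred false p ts] is the atom p(ts) and [Pred true p ts] its dual. *)
Inductive atom (Sg : signature) :=
| ATrue
| AFalse
| Pred (b : bool) (p : predsym Sg) (ts : {ffun 'I_(predar p) -> term Sg}).
Arguments ATrue {Sg}.
Arguments AFalse {Sg}.
Arguments Pred {Sg} b p ts.

Inductive formula (Sg : signature) :=
| Atom of atom Sg
| And of formula Sg & formula Sg
| Or of formula Sg & formula Sg
| Ex of var & formula Sg
| All of var & formula Sg.
Arguments Atom {Sg} a.
Arguments And {Sg} A B.
Arguments Or {Sg} A B.
Arguments Ex {Sg} x A.
Arguments All {Sg} x A.

Definition ftrue {Sg} : formula Sg := Atom ATrue.

Definition subst (Sg : signature) := var -> term Sg.

Section Syntax.
Variable Sg : signature.
Implicit Types (s : subst Sg) (t : term Sg) (a : atom Sg) (A B : formula Sg).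

Definition adual a : atom Sg :=
  match a with
  | ATrue => AFalse
  | AFalse => ATrue
  | Pred b p ts => Pred (~~ b) p ts
  end.

Fixpoint tvars t : seq var :=
  match t with
  | Var x => [:: x]
  | Fn f ts => flatten [seq tvars (ts i) | i <- enum 'I_(funar f)]
  end.

Definition avars a : seq var :=
  match a with
  | Pred _ p ts => flatten [seq tvars (ts i) | i <- enum 'I_(predar p)]
  | _ => [::]
  end.

Fixpoint fvars A : seq var :=
  match A with
  | Atom a => avars a
  | And A B | Or A B => fvars A ++ fvars B
  | Ex x A | All x A => [seq y <- fvars A | y != x]
  end.

Fixpoint bvars A : seq var :=
  match A with
  | Atom _ => [::]
  | And A B | Or A B => bvars A ++ bvars B
  | Ex x A | All x A => x :: bvars A
  end.

Definition rectified A : bool :=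
  uniq (bvars A) && ~~ has (mem (fvars A)) (bvars A).

Fixpoint false_free A : bool :=
  match A with
  | Atom AFalse => false
  | Atom _ => true
  | And A B | Or A B => false_free A && false_free B
  | Ex _ A | All _ A => false_free A
  end.

Fixpoint tsubst s t : term Sg :=
  match t with
  | Var x => s x
  | Fn f ts => Fn f [ffun i => tsubst s (ts i)]
  end.

Definition asubst s a : atom Sg :=
  match a with
  | Pred b p ts => Pred b p [ffun i => tsubst s (ts i)]
  | a => a
  end.

(* Only free occurrences are replaced and bound variables are never renamed;
   capture is excluded by [free_for] in the rule that uses [fsubst]. *)
Fixpoint fsubst s A : formula Sg :=
  match A with
  | Atom a => Atom (asubst s a)
  | And A B => And (fsubst s A) (fsubst s B)
  | Or A B => Or (fsubst s A) (fsubst s B)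
  | Ex y A => Ex y (fsubst [eta s with y |-> Var y] A)
  | All y A => All y (fsubst [eta s with y |-> Var y] A)
  end.

Definition single (x : var) t : subst Sg := [eta Var with x |-> t].

Fixpoint free_for t (x : var) A : bool :=
  match A with
  | Atom _ => true
  | And A B | Or A B => free_for t x A && free_for t x B
  | Ex y A | All y A =>
      [|| x == y, x \notin fvars A | (y \notin tvars t) && free_for t x A]
  end.

(* Valued in [Type]: tracing atom occurrences through an instance of the
   equivalence rule needs to know how the two formulas are related, since
   A \/ A, say, is equivalent to itself in more than one way. *)
Inductive eqv : formula Sg -> formula Sg -> Type :=
| eqv_refl A : eqv A A
| eqv_sym A B : eqv A B -> eqv B A
| eqv_trans A B C : eqv A B -> eqv B C -> eqv A C
| eqv_and A A' B B' : eqv A A' -> eqv B B' -> eqv (And A B) (And A' B')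
| eqv_or A A' B B' : eqv A A' -> eqv B B' -> eqv (Or A B) (Or A' B')
| eqv_ex x A A' : eqv A A' -> eqv (Ex x A) (Ex x A')
| eqv_all x A A' : eqv A A' -> eqv (All x A) (All x A')
| eqv_andC A B : eqv (And A B) (And B A)
| eqv_andA A B C : eqv (And A (And B C)) (And (And A B) C)
| eqv_orC A B : eqv (Or A B) (Or B A)
| eqv_orA A B C : eqv (Or A (Or B C)) (Or (Or A B) C)
| eqv_allC x y A : eqv (All x (All y A)) (All y (All x A))
| eqv_exC x y A : eqv (Ex x (Ex y A)) (Ex y (Ex x A))
| eqv_all_or x A B : x \notin fvars B -> eqv (All x (Or A B)) (Or (All x A) B)
| eqv_ex_and x A B : x \notin fvars B -> eqv (Ex x (And A B)) (And (Ex x A) B).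

Inductive context :=
| Hole
| AndL of context & formula Sg
| AndR of formula Sg & context
| OrL of context & formula Sg
| OrR of formula Sg & context
| ExC of var & context
| AllC of var & context.

Fixpoint plug (K : context) A : formula Sg :=
  match K with
  | Hole => A
  | AndL K B => And (plug K A) B
  | AndR B K => And B (plug K A)
  | OrL K B => Or (plug K A) B
  | OrR B K => Or B (plug K A)
  | ExC x K => Ex x (plug K A)
  | AllC x K => All x (plug K A)
  end.

(* [rule B A]: premise B, conclusion A. *)
Inductive rule : formula Sg -> formula Sg -> Type :=
| r_all x : rule ftrue (All x ftrue)
| r_ai a : rule ftrue (Or (Atom a) (Atom (adual a)))
| r_t A : rule A (And A ftrue)
| r_s A B C : rule (And A (Or B C)) (Or (And A B) C)
| r_mix A B : rule (And A B) (Or A B)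
| r_ex x t A : free_for t x A -> rule (fsubst (single x t) A) (Ex x A)
| r_eqv B A : eqv A B -> rule B A.

Inductive step : formula Sg -> formula Sg -> Type :=
| Step K B A of rule B A : step (plug K B) (plug K A).

(* Read from the premise B at the top downwards; [DStep] adds one more step at
   the bottom. *)
Inductive derivation (B : formula Sg) : formula Sg -> Type :=
| DNil : derivation B B
| DStep C A of derivation B C & step C A : derivation B A.

Fixpoint nb_steps B A (Phi : derivation B A) : nat :=
  match Phi with
  | DNil => 0
  | DStep _ _ Phi _ => (nb_steps Phi).+1
  end.

(* Every line is rectified. For a rectified conclusion this excludes only
   instances of [r_ex] whose term t contains a variable that is also bound
   elsewhere in the premise (the variable convention). *)
Fixpoint rectified_derivation B A (Phi : derivation B A) : bool :=
  rectified A &&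
  match Phi with
  | DNil => true
  | DStep _ _ Phi _ => rectified_derivation Phi
  end.

(* The composition, from the conclusion upwards, of the substitutions [x/t] of
   the [r_ex] instances. So x is sent to t in which the variables instantiated
   further up have in turn been replaced: with the bare map x |-> t the labels
   of a link need not become dual, as for
   Ex y (Ex x (p(x,y) \/ ~p(f(y),c))), where x |-> f(y) and then y |-> c. *)
Definition rule_subst B A (r : rule B A) : subst Sg :=
  match r with
  | r_ex x t _ _ => single x t
  | _ => Var
  end.

Definition step_subst B A (r : step B A) : subst Sg :=
  match r with Step _ _ _ r => rule_subst r end.

Fixpoint delta B A (Phi : derivation B A) : subst Sg :=
  match Phi with
  | DNil => Var
  | DStep _ _ Phi r => fun x => tsubst (delta Phi) (step_subst r x)
  end.

End Syntax.

Record lgraph (Sg : signature) := LGraph {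
  vertex : finType;
  edge : rel vertex;
  label : vertex -> var + atom Sg }.
Arguments edge {Sg} l _ _.
Arguments label {Sg} l _.

Section GraphOfFormula.
Variable Sg : signature.
Implicit Types (G H : lgraph Sg) (A B : formula Sg).

Definition gvertex (l : var + atom Sg) : lgraph Sg :=
  @LGraph Sg unit (fun _ _ => false) (fun _ => l).

Definition gcombine (join : bool) G H : lgraph Sg :=
  @LGraph Sg (vertex G + vertex H)%type
    (fun u v => match u, v with
                | inl u, inl v => edge G u v
                | inr u, inr v => edge H u v
                | _, _ => join
                end)
    (fun u => match u with inl u => label G u | inr u => label H u end).

Definition gunion := gcombine false.
Definition gjoin := gcombine true.

Fixpoint graph A : lgraph Sg :=
  match A with
  | Atom a => gvertex (inr a)
  | And A B => gjoin (graph A) (graph B)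
  | Or A B => gunion (graph A) (graph B)
  | Ex x A => gjoin (gvertex (inl x)) (graph A)
  | All x A => gunion (gvertex (inl x)) (graph A)
  end.

Definition occ A := vertex (graph A).

Definition sum_map T1 T2 U1 U2 (f : T1 -> U1) (g : T2 -> U2) (u : T1 + T2) : U1 + U2 :=
  match u with inl x => inl (f x) | inr y => inr (g y) end.

Definition sum_swap T U (u : T + U) : U + T :=
  match u with inl x => inr x | inr y => inl y end.

Definition sum_assoc T U V (u : T + (U + V)) : (T + U) + V :=
  match u with
  | inl x => inl (inl x)
  | inr (inl y) => inl (inr y)
  | inr (inr z) => inr z
  end.

Definition sum_assocV T U V (u : (T + U) + V) : T + (U + V) :=
  match u with
  | inl (inl x) => inl x
  | inl (inr y) => inr (inl y)
  | inr z => inr (inr z)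
  end.

Definition sum_exchange T U V (u : T + (U + V)) : U + (T + V) :=
  match u with
  | inl x => inr (inl x)
  | inr (inl y) => inl y
  | inr (inr z) => inr (inr z)
  end.

(* Both directions at once, because of [eqv_sym]. *)
Fixpoint eqv_trace A B (e : eqv A B) : (occ A -> occ B) * (occ B -> occ A) :=
  match e in eqv A B return (occ A -> occ B) * (occ B -> occ A) with
  | eqv_refl A => (id, id)
  | eqv_sym A B e => let: (f, g) := eqv_trace e in (g, f)
  | eqv_trans A B C e1 e2 =>
      let: (f1, g1) := eqv_trace e1 in
      let: (f2, g2) := eqv_trace e2 in
      (f2 \o f1, g1 \o g2)
  | eqv_and _ _ _ _ e1 e2 =>
      let: (f1, g1) := eqv_trace e1 in
      let: (f2, g2) := eqv_trace e2 in
      (sum_map f1 f2, sum_map g1 g2)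
  | eqv_or _ _ _ _ e1 e2 =>
      let: (f1, g1) := eqv_trace e1 in
      let: (f2, g2) := eqv_trace e2 in
      (sum_map f1 f2, sum_map g1 g2)
  | eqv_ex _ _ _ e | eqv_all _ _ _ e =>
      let: (f, g) := eqv_trace e in (sum_map id f, sum_map id g)
  | eqv_andC _ _ | eqv_orC _ _ => (@sum_swap _ _, @sum_swap _ _)
  | eqv_andA _ _ _ | eqv_orA _ _ _ => (@sum_assoc _ _ _, @sum_assocV _ _ _)
  | eqv_allC _ _ _ | eqv_exC _ _ _ => (@sum_exchange _ _ _, @sum_exchange _ _ _)
  | eqv_all_or _ _ _ _ | eqv_ex_and _ _ _ _ => (@sum_assoc _ _ _, @sum_assocV _ _ _)
  end.

Fixpoint fsubst_trace (s : subst Sg) A : occ A -> occ (fsubst s A) :=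
  match A return occ A -> occ (fsubst s A) with
  | Atom _ => id
  | And A B | Or A B => sum_map (@fsubst_trace s A) (@fsubst_trace s B)
  | Ex y A | All y A => sum_map id (@fsubst_trace [eta s with y |-> Var y] A)
  end.

(* What becomes of an occurrence of the conclusion of an inference, read
   upwards: it continues in the premise, or is consumed by the instance of
   [r_ai], or is introduced in another way. *)
Variant origin (T : Type) := Premise of T | Consumed | Introduced.
Arguments Consumed {T}.
Arguments Introduced {T}.

Definition origin_map T U (f : T -> U) (o : origin T) : origin U :=
  match o with
  | Premise u => Premise (f u)
  | Consumed => Consumed
  | Introduced => Introduced
  end.

Definition rule_trace B A (r : rule B A) : occ A -> origin (occ B) :=
  match r in rule B A return occ A -> origin (occ B) with
  | r_all _ => fun u => match u with inl _ => Introduced | inr v => Premise v end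
  | r_ai _ => fun _ => Consumed
  | r_t _ => fun u => match u with inl v => Premise v | inr _ => Introduced end
  | r_s _ _ _ => fun u => Premise (sum_assocV u)
  | r_mix _ _ => fun u => Premise u
  | r_ex x t A _ => fun u =>
      match u with
      | inl _ => Introduced
      | inr v => Premise (fsubst_trace (single x t) v)
      end
  | r_eqv _ _ e => fun u => Premise ((eqv_trace e).1 u)
  end.

Fixpoint plug_trace B A (f : occ A -> origin (occ B)) (K : context Sg) :
    occ (plug K A) -> origin (occ (plug K B)) :=
  match K return occ (plug K A) -> origin (occ (plug K B)) with
  | Hole => f
  | AndL K _ | OrL K _ => fun u =>
      match u with
      | inl v => origin_map inl (plug_trace f v)
      | inr w => Premise (inr w)
      end
  | AndR _ K | OrR _ K | ExC _ K | AllC _ K => fun u =>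
      match u with
      | inl w => Premise (inl w)
      | inr v => origin_map inr (plug_trace f v)
      end
  end.

Definition step_trace B A (r : step B A) : occ A -> origin (occ B) :=
  match r in step B A return occ A -> origin (occ B) with
  | Step K _ _ r => plug_trace (rule_trace r) (K := K)
  end.

(* The number, counted from the top, of the step whose [r_ai] instance consumes
   the occurrence. *)
Fixpoint consumer B A (Phi : derivation B A) : occ A -> option nat :=
  match Phi in derivation _ A return occ A -> option nat with
  | DNil => fun _ => None
  | DStep _ _ Phi r => fun u =>
      match step_trace r u with
      | Premise v => consumer Phi v
      | Consumed => Some (nb_steps Phi)
      | Introduced => None
      end
  end.

Definition same_ai B A (Phi : derivation B A) : rel (occ A) :=
  fun u v => isSome (consumer Phi u) && (consumer Phi u == consumer Phi v).

End GraphOfFormula.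

Section Fograph.
Variables (Sg : signature) (G : lgraph Sg).
Implicit Types (u v w b : vertex G) (x y : var) (M W : {set vertex G}).

Definition cograph : Prop :=
  [/\ symmetric (edge G), irreflexive (edge G) &
      ~ exists u v w z : vertex G,
        [/\ uniq [:: u; v; w; z],
            [&& edge G u v, edge G v w & edge G w z] &
            ~~ [|| edge G u w, edge G u z | edge G v z]]].

Definition neighbours v : {set vertex G} := [set w | edge G v w].

Definition is_module M : bool :=
  [forall v in M, forall w in M, neighbours v :\: M == neighbours w :\: M].

Definition is_strong M : bool :=
  is_module M &&
  [forall M' : {set vertex G}, is_module M' ==>
     [|| M \subset M', M' \subset M | [disjoint M & M']]].

Definition proper_strong_module M : bool := is_strong M && (2 <= #|M|).

Definition is_literal v : Prop := exists a, label G v = inr a.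

Definition is_binder x b : Prop := label G b = inl x.

Definition is_scope b M : Prop :=
  [/\ proper_strong_module M, b \in M &
      forall M', proper_strong_module M' -> b \in M' -> M \subset M'].

Definition existential_binder x b : Prop :=
  is_binder x b /\
  exists2 M, is_scope b M & forall v, v \in M -> v != b -> edge G b v.

Definition universal_binder x b : Prop :=
  is_binder x b /\
  exists2 M, is_scope b M & forall v, v \in M -> v != b -> ~~ edge G b v.

Definition fograph : Prop :=
  [/\ cograph,
      exists v, is_literal v &
      forall x b, is_binder x b ->
        exists M, [/\ is_scope b M,
                      exists2 v, v \in M & is_literal v &
                      forall b', b' \in M -> is_binder x b' -> b' = b]].

Definition induces_matching (e : vertex G -> vertex G -> Prop) W : Prop :=
  W <> set0 /\ forall w, w \in W -> exists! v, v \in W /\ e w v.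

End Fograph.

Record linked_graph (Sg : signature) := LinkedGraph {
  lgraph_of :> lgraph Sg;
  link_per : rel (vertex lgraph_of) }.
Arguments link_per {Sg} l _ _.

Definition pre_dual (Sg : signature) (a a' : atom Sg) : Prop :=
  exists b p ts ts', a = Pred b p ts /\ a' = Pred (~~ b) p ts'.

Section Fonet.
Variables (Sg : signature) (L : linked_graph Sg).
Implicit Types (v w : vertex L) (d : subst Sg).

Definition is_link v w : Prop := v != w /\ link_per L v w.

Definition linked_fograph : Prop :=
  [/\ fograph L,
      symmetric (link_per L) /\ transitive (link_per L),
      forall v, link_per L v v ->
        exists2 w, v != w & [set u | link_per L v u] = [set v; w],
      forall v w, is_link v w ->
        exists a a', [/\ label L v = inr a, label L w = inr a' & pre_dual a a'] &
      forall v a, label L v = inr a -> a = ATrue \/ link_per L v v].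

(* Only variables of existential binders may be substituted. *)
Definition dualizer d : Prop :=
  (forall x, d x <> Var x -> exists b : vertex L, existential_binder x b) /\
  (forall v w a a', is_link v w -> label L v = inr a -> label L w = inr a' ->
     asubst d a' = adual (asubst d a)).

Definition most_general_dualizer d : Prop :=
  dualizer d /\
  forall d', dualizer d' -> exists s : subst Sg, forall x, d' x = tsubst s (d x).

Definition is_dependency v w : Prop :=
  exists x y, [/\ existential_binder x v, universal_binder y w &
                  exists2 d, most_general_dualizer d & y \in tvars (d x)].

Definition leap v w : Prop :=
  [\/ is_link v w, is_dependency v w | is_dependency w v].

Definition induces_bimatching (W : {set vertex L}) : Prop :=
  induces_matching (edge L) W /\ induces_matching leap W.

Definition fonet : Prop :=
  [/\ linked_fograph, exists d, dualizer d &
      ~ exists W : {set vertex L}, induces_bimatching W].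

End Fonet.

Definition fonet_of (Sg : signature) (A : formula Sg) (Phi : derivation ftrue A) :
    linked_graph Sg :=
  LinkedGraph (lgraph_of := graph A) (same_ai Phi).

(* Main.v *)
Require Import Defs.
From mathcomp Require Import all_boot.

(** A vertex set inducing a bimatching would trace a cycle that alternates
between edges of the fograph and leaps, without any further fograph edge between
its vertices. No such cycle exists, by induction along the derivation from the
top downwards: a cycle in the graph of the conclusion of a rule gives one in the
graph of its premise. Switch and mix only delete edges, all those between
two vertex sets; when they are put back, they become chords of the cycle, and a
shortcut through a suitable chord is again an alternating cycle without
chords. An instance x := t of the existential rule makes x depend on a universal
y only through a variable z of t that is bound above x; in the cycle, x is
replaced by z, which is adjacent to everything x is adjacent to, and the
additional edges are again cut short.

The induction does not follow the substitution of the derivation itself, which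
may create spurious dependencies (through vacuous quantifiers, or through a
variable that is free in t and bound later), but some dualizer chosen along the
way. It is an instance of the most general one, hence has at least
its dependencies. *)

Set Implicit Arguments.
Unset Strict Implicit.
Unset Printing Implicit Defensive.

(** * Chordless alternating cycles *)

(** Chordlessness is required of fograph edges only. The dualizer chosen along the derivation may
    have more dependencies than the most general one, so its leaps need not induce a matching on the
    vertices of a bimatching; the fograph edges do not depend on the dualizer.

    The loops at existential binders are forced by the existential rule. If the binder of the
    variable z of t lies itself on the cycle, then it is adjacent to the binder of x, so the two
    form one of the edges of the chordless cycle, and replacing x by z turns this edge into a loop.
    Moreover, different dependencies of x may go through different z, so x has no single image in
    the premise: it is replaced by one copy for each leap partner, and the edges that a copy has in
    excess of x are added partner by partner. *)

Lemma split_last (T : Type) (a : pred T) (s : seq T) :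
  has a s -> exists s1 x s2, [/\ s = s1 ++ x :: s2, a x & ~~ has a s2].
Proof.
elim: s => //= y s IH; case has_s: (has a s).
  rewrite orbT => _.
  by have [s1 [x [s2 [-> ax s2a]]]] := IH has_s; exists (y :: s1), x, s2.
by rewrite orbF => ay; exists [::], y, s; rewrite has_s.
Qed.

Lemma split_first (T : Type) (a : pred T) (s : seq T) :
  has a s -> exists s1 x s2, [/\ s = s1 ++ x :: s2, a x & ~~ has a s1].
Proof.
elim: s => //= y s IH; case: (boolP (a y)) => [ay _ | nay /= has_s].
  by exists [::], y, s.
have [s1 [x [s2 [-> ax s1a]]]] := IH has_s.
by exists (y :: s1), x, s2; rewrite /= negb_or nay.
Qed.

Section AlternatingCycle.
Variable T : eqType.
Implicit Types (e l : rel T) (p q : T * T) (c : seq (T * T)).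

Definition apart e p q :=
  ~~ [|| e p.1 q.1, e p.1 q.2, e p.2 q.1 | e p.2 q.2].

Definition hop l p q := l p.2 q.1.

Definition swap p := (p.2, p.1).

(* A chordless cycle alternating between [e] and [l], given by the list of its
   [e]-edges. *)
Definition alternating e l c :=
  [&& all (fun p => e p.1 p.2) c, cycle (hop l) c & pairwise (apart e) c].

Definition acyclic e l := forall c, alternating e l c -> c = [::].

Lemma apart_sym e : symmetric e -> symmetric (apart e).
Proof.
move=> se p q; rewrite /apart (se p.1) (se p.1) (se p.2) (se p.2).
by congr (~~ _); rewrite [X in _ || X]orbCA.
Qed.

Lemma alternating_rot n e l c :
  symmetric e -> alternating e l (rot n c) = alternating e l c.
Proof.
move=> /apart_sym se; rewrite /alternating rot_cycle /rot.
rewrite -[c in RHS](cat_take_drop n) !pairwise_cat !all_cat cat_take_drop.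
have -> : allrel (apart e) (drop n c) (take n c) = allrel (apart e) (take n c) (drop n c).
  by rewrite allrelC; apply: eq_allrel => p q; apply: se.
by case: (all _ (drop _ _)) (all _ (take _ _)) (cycle _ _) (allrel _ _ _) (pairwise _ (drop _ _)) (pairwise _ (take _ _)) => [] [] [] [] [] [].
Qed.

Lemma pairwise_rev (U : Type) (r : rel U) (s : seq U) :
  symmetric r -> pairwise r (rev s) = pairwise r s.
Proof.
move=> sr; elim: s => //= x s IH; rewrite rev_cons pairwise_rcons IH all_rev.
by congr andb; apply: eq_all => y.
Qed.

Lemma alternating_rev e l c : symmetric e -> symmetric l ->
  alternating e l (rev (map swap c)) = alternating e l c.
Proof.
move=> se sl; rewrite /alternating all_rev rev_cycle pairwise_rev; last exact: apart_sym.
rewrite all_map cycle_map pairwise_map; congr [&& _, _ & _].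
- by apply: eq_all => p /=; rewrite se.
- by apply: eq_cycle => p q; rewrite /= /hop sl.
- apply: eq_pairwise => p q; rewrite /= /apart /=; congr (~~ _).
  by case: (e p.1 q.1) (e p.1 q.2) (e p.2 q.1) (e p.2 q.2) => [] [] [] [].
Qed.

Lemma alternating_edge e l c p : alternating e l c -> p \in c -> e p.1 p.2.
Proof. by case/and3P=> /allP + _ _; apply. Qed.

Lemma alternating_apart e l c p q : symmetric e -> alternating e l c ->
  p \in c -> q \in c -> p != q -> apart e p q.
Proof.
move=> se /and3P[_ _ /(pairwiseP p) pw] /(nthP p)[i ltic <-] /(nthP p)[j ltjc <-].
have sa := apart_sym se.
by case: (ltngtP i j) => [ltij|ltji|->]; rewrite ?eqxx // => _; [|rewrite sa]; apply: pw.
Qed.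

(* If an edge is added between the end of one pair and the start of a later one,
   it closes the stretch of cycle between them. *)
Lemma alternating_shortcut e e' l c1 c2 p q :
  (forall r1 r2, r1 \in c1 -> r2 \in c1 -> apart e r1 r2 -> apart e' r1 r2) ->
  subrel e e' -> e' q.1 p.2 ->
  (forall r, r \in c1 -> apart e p r -> apart e q r -> apart e' (q.1, p.2) r) ->
  symmetric e ->
  alternating e l (p :: c1 ++ q :: c2) -> alternating e' l ((q.1, p.2) :: c1).
Proof.
move=> keep sub new far se /and3P[/= /andP[_ ed]].
rewrite rcons_cat cat_path /= => /and3P[pc1 hq _].
rewrite all_cat pairwise_cat /= => /and3P[/and3P[pc _ _] aqc /andP[pw _]].
apply/and3P; split; rewrite /= ?new //=.
- by move: ed; rewrite all_cat => /andP[/allP ed _]; apply/allP=> r /ed/sub.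
- by rewrite rcons_path; case: (c1) pc1 hq => //= r c; rewrite /hop /= => /andP[-> ->].
apply/andP; split.
  apply/allP=> r rc; apply: far => //; first by move/allP: pc; apply.
  rewrite apart_sym //; move/allrelP: aqc; apply=> //; exact: mem_head.
by apply/(sub_in_pairwise (P := [in c1]) _ _ pw); [exact: keep | apply/allP].
Qed.

(** If no pair meets [S], or none meets [U], then no added edge is a chord and [c] itself will do.
    Otherwise let [q] be the first pair meeting [U] after some pair that meets [S], and [p'] the
    last pair before [q] that meets [S]. The stretch strictly between them avoids both sets, so it
    gains no chord, and the new edge between [p'.2] in [S] and [q.1] in [U] closes it. *)
Lemma alternating_fill e e' l (S U : pred T) c :
  symmetric e ->
  (forall a b, e' a b = [|| e a b, S a && U b | S b && U a]) ->
  (forall p, p \in c -> S p.1 || S p.2 -> S p.2) ->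
  (forall p q, p \in c -> q \in c -> S p.1 || S p.2 -> U q.1 || U q.2 ->
       [&& U q.1, U q.2 & p != q]) ->
  alternating e l c -> c != [::] ->
  exists2 c', alternating e' l c' & c' != [::].
Proof.
move=> se e'E Sc Uc altc c0.
pose s p := S p.1 || S p.2; pose u p := U p.1 || U p.2.
have ss' : subrel e e' by move=> a b eab; rewrite e'E eab.
have keep (r1 r2 : T * T) : ~~ s r1 -> ~~ s r2 -> apart e r1 r2 -> apart e' r1 r2.
  by rewrite /s !negb_or /apart !e'E => /andP[/negPf-> /negPf->] /andP[/negPf-> /negPf->]; rewrite !orbF.
have keep' (r1 r2 : T * T) : ~~ u r1 -> ~~ u r2 -> apart e r1 r2 -> apart e' r1 r2.
  rewrite /u !negb_or /apart !e'E => /andP[/negPf-> /negPf->] /andP[/negPf-> /negPf->].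
  by rewrite !andbF !orbF.
have unchanged a : (forall r1 r2 : T * T, ~~ a r1 -> ~~ a r2 -> apart e r1 r2 -> apart e' r1 r2) ->
    ~~ has a c -> exists2 c', alternating e' l c' & c' != [::].
  move=> ka; rewrite -all_predC => nac; exists c => //.
  case/and3P: altc => ed hc pw; apply/and3P; split=> //.
    by apply/allP=> p /(allP ed)/ss'.
  by apply: (sub_in_pairwise _ nac pw) => r1 r2; apply: ka.
case: (boolP (has s c)) => [|/unchanged]; last exact.
case: (boolP (has u c)) => [|/unchanged]; last by move=> + _; apply.
move=> huc /hasP[p pc sp].
have disj r : r \in c -> s r -> ~~ u r.
  by move=> rc sr; apply/negP=> ur; have /and3P[_ _] := Uc _ _ rc rc sr ur; rewrite eqxx.
have [i c1 rotc] := rot_to pc.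
have altr : alternating e l (p :: c1) by rewrite -rotc alternating_rot.
have memr : p :: c1 =i c by move=> r; rewrite -rotc mem_rot.
have : has u c1.
  move: huc; rewrite -(has_rot i) rotc /= => /orP[up|//].
  by move: (disj _ pc sp); rewrite up.
case/split_first=> c2 [q [c3 [c1E uq nuc2]]].
have /split_last[d1 [p' [d2 [dE sp' nsd2]]]] : has s (p :: c2) by apply/hasP; exists p; rewrite ?mem_head.
have rE : p :: c1 = d1 ++ (p' :: d2 ++ q :: c3).
  by rewrite c1E -[LHS]/((p :: c2) ++ q :: c3) dE -catA.
have altd : alternating e l (p' :: d2 ++ q :: (c3 ++ d1)).
  move: altr; rewrite rE -(alternating_rot (size d1)) // rot_size_cat.
  by rewrite /= -catA.
exists ((q.1, p'.2) :: d2) => //.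
have p'c : p' \in c by rewrite -memr rE mem_cat mem_head orbT.
have qc : q \in c by rewrite -memr rE mem_cat inE mem_cat mem_head !orbT.
have nud2 : ~~ has u d2.
  apply/hasPn=> r rd; have: r \in p :: c2 by rewrite dE mem_cat inE rd !orbT.
  rewrite inE => /predU1P[->|rc2]; last exact: (hasPn nuc2).
  exact: disj pc sp.
apply: alternating_shortcut altd => //.
- by move=> r1 r2 r1d r2d; apply: keep; apply: (hasPn nsd2).
- have /and3P[Uq _ _] := Uc _ _ pc qc sp uq.
  by rewrite e'E Uq (Sc _ p'c sp') !orbT.
- move=> r rd; move: (hasPn nsd2 _ rd) (hasPn nud2 _ rd).
  rewrite /s /u /apart !e'E /= !negb_or => /andP[/negPf-> /negPf->] /andP[/negPf-> /negPf->].
  by rewrite !(andbF, andFb, orbF, orFb) => /and4P[_ _ -> ->] /and4P[-> -> _ _].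
Qed.

(** Reversing the cycle exchanges the two components of each pair, so it does not matter on which
    side the pairs that meet [S] lie in it, as long as it is the same side for all of them. *)
Lemma acyclic_fill e e' l (S U : pred T) :
  symmetric e -> symmetric l ->
  (forall a b, e' a b = [|| e a b, S a && U b | S b && U a]) ->
  (forall c, alternating e l c ->
     ((forall p, p \in c -> S p.1 || S p.2 -> S p.1) \/
      (forall p, p \in c -> S p.1 || S p.2 -> S p.2)) /\
     (forall p q, p \in c -> q \in c -> S p.1 || S p.2 -> U q.1 || U q.2 ->
       [&& U q.1, U q.2 & p != q])) ->
  acyclic e' l -> acyclic e l.
Proof.
move=> se sl e'E Hc acy c altc; apply/eqP/negP=> /negP c0.
suff [c' /acy->] : exists2 c', alternating e' l c' & c' != [::] by [].
have [[Sc|Sc] Uc] := Hc c altc; last exact: alternating_fill altc c0.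
rewrite -alternating_rev // in altc.
apply: (alternating_fill se e'E _ _ altc); last by case: (c) c0 => // p c1; rewrite /= rev_cons -size_eq0 size_rcons.
  by move=> p; rewrite mem_rev => /mapP[p' p'c ->] /=; rewrite orbC; apply: Sc.
move=> p q; rewrite !mem_rev => /mapP[p' p'c ->] /mapP[q' q'c ->] /=.
rewrite orbC => sp; rewrite orbC => uq; have /and3P[-> -> /=] := Uc _ _ p'c q'c sp uq.
by apply: contraNneq; rewrite [p']surjective_pairing [q']surjective_pairing /swap => -[-> ->].
Qed.

(** Chordlessness yields the conditions of [acyclic_fill]. If the pair [p] leaves [S] at its second
    component, then [p.2] is adjacent to all of [S], so no other pair has its second component in
    [S]. If a pair joins a vertex of [U] to some [z] outside [U], then [z] is adjacent to all of
    [S], which gives a chord to any other pair that meets [S]. *)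
Lemma acyclic_join e e' l (S U : pred T) :
  symmetric e -> symmetric l ->
  (forall a b, e' a b = [|| e a b, S a && U b | S b && U a]) ->
  (forall a u, S a -> U u -> (a != u) && ~~ e a u) ->
  (forall a b z, S a -> S b -> ~~ S z -> e a z -> e b z) ->
  (forall a u z, S a -> U u -> ~~ U z -> e u z -> e a z) ->
  acyclic e' l -> acyclic e l.
Proof.
move=> se sl e'E SU modS modU; apply: acyclic_fill => // c altc; split.
  have [/hasP[p pc /andP[S1 nS2]] | /hasPn Sc] := boolP (has (fun p => S p.1 && ~~ S p.2) c); last first.
    by right=> p pc /orP[S1|//]; have := Sc p pc; rewrite S1 negbK.
  left=> q qc Sq; case: (eqVneq p q) => [<- //|pq].
  have := alternating_apart se altc pc qc pq; rewrite /apart !negb_or.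
  have ep := alternating_edge altc pc.
  case/orP: Sq => // Sq2 /and4P[_ _ _].
by rewrite [e p.2 q.2]se (modS _ _ _ S1).
have side u z p q : p \in c -> q \in c -> S p.1 || S p.2 ->
    (q = (u, z)) \/ (q = (z, u)) -> U u -> U z.
  move=> pc qc Sp qE Uu; apply/negPn/negP=> nUz.
  have euz : e u z.
    by have := alternating_edge altc qc; case: qE => -> //=; rewrite se.
  have zS a : S a -> e a z by move=> Sa; apply: modU Uu nUz euz.
  case: (eqVneq p q) => [pq|pq]; last first.
    have := alternating_apart se altc pc qc pq; rewrite /apart.
    by case: qE => -> /=; case/orP: Sp => /zS ->; rewrite /= ?orbT.
  have nSu : ~~ S u by apply/negP=> Su; have := SU _ _ Su Uu; rewrite eqxx.
  have Sz : S z by move: Sp; rewrite pq; case: qE => -> /=; rewrite (negPf nSu) ?orbF.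
  by have := SU _ _ Sz Uu; rewrite se euz andbF.
move=> p [u z] pc qc Sp /= Uq.
have [Uu Uz] : U u /\ U z.
  case/orP: Uq => Uu; split=> //; first exact: (side u z p _ pc qc Sp (or_introl erefl) Uu).
  exact: (side z u p _ pc qc Sp (or_intror erefl) Uu).
rewrite Uu Uz /=; apply: contraTneq Sp => ->; rewrite negb_or /=.
by apply/andP; split; apply/negP=> Sa; have := SU _ _ Sa; [move/(_ u Uu) | move/(_ z Uz)]; rewrite eqxx.
Qed.

(** This disposes of the leaps that no chordless cycle can use: the new link of an [ai] instance,
    and the dependencies of a new existential binder that are not inherited from an older one. *)
Lemma acyclic_restrict e l (P : rel T) :
  (forall c p q, alternating e l c -> p \in c -> q \in c -> l p.2 q.1 -> P p.2 q.1) ->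
  acyclic e (fun u v => l u v && P u v) -> acyclic e l.
Proof.
move=> lP acy c altc; apply: acy; case/and3P: (altc) => ed hc pw; apply/and3P; split=> //.
apply: (sub_in_cycle (P := [in c]) _ _ hc); last exact/allP.
by move=> p q pc qc lpq; apply/andP; split=> //; apply: lP altc pc qc lpq.
Qed.

Lemma alternating_hops e l c p : alternating e l c -> p \in c ->
  exists q r, [/\ q \in c, r \in c, l q.2 p.1 & l p.2 r.1].
Proof.
case/and3P=> _ hc _ pc; exists (prev c p), (next c p).
rewrite mem_prev mem_next pc; split=> //; [exact: prev_cycle hc pc | exact: next_cycle hc pc].
Qed.

End AlternatingCycle.

(* It is enough to consider cycles in which every vertex comes with its
   [l]-neighbour. *)
Definition decorated (T : eqType) (l : rel T) : rel (T * T) :=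
  fun a b => [&& l a.1 b.1, a.2 == b.1 & b.2 == a.1].

Lemma alternating_uniq (T : eqType) (e l : rel T) c :
  alternating e l c -> uniq c.
Proof.
case/and3P=> /allP ed _; elim: c ed => //= p c IH ed /andP[apc pw].
rewrite IH //; last by move=> q qc; apply: ed; rewrite inE qc orbT.
rewrite andbT; apply/negP=> pc; move/allP/(_ p pc): apc.
by rewrite /apart ed ?mem_head ?orbT.
Qed.

Lemma acyclic_decorated (T : eqType) (e l : rel T) :
  acyclic (fun a b => e a.1 b.1) (decorated l) -> acyclic e l.
Proof.
move=> acy c altc; have uc := alternating_uniq altc.
(* Each end of a pair is tagged with the other end of its hop. As [c] has no repetition, [prev] and
   [next] are inverse on it, so the tags of two consecutive pairs fit together. *)
pose F p := ((p.1, (prev c p).2), (p.2, (next c p).1)).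
suff /acy : alternating (fun a b => e a.1 b.1) (decorated l) (map F c) by case: (c).
case/and3P: altc => ed hc pw; apply/and3P; split.
- by rewrite all_map.
- rewrite cycle_map; apply: cycle_from_next => // p pc.
  rewrite /= /hop /decorated /F /=.
  by rewrite prev_next // !eqxx !andbT; exact: next_cycle hc pc.
- by rewrite pairwise_map.
Qed.

Lemma acyclic_map (T T' : eqType) (f : T -> T') (P : pred T) (e l : rel T) (e' l' : rel T') :
  (forall u v, l u v -> [&& P u, P v & l' (f u) (f v)]) ->
  (forall u v, P u -> P v -> e u v = e' (f u) (f v)) ->
  acyclic e' l' -> acyclic e l.
Proof.
move=> fl fe acy c altc.
have Pc : all (fun p => P p.1 && P p.2) c.
  apply/allP=> p pc; have [q [r [_ _ /fl/and3P[_ -> _] /fl/and3P[-> _ _]]]] := alternating_hops altc pc.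
  by [].
suff /acy : alternating e' l' (map (fun p => (f p.1, f p.2)) c) by case: (c).
case/and3P: altc => ed hc pw; apply/and3P; split.
- rewrite all_map; apply/allP=> p pc; have /andP[P1 P2] := allP Pc _ pc.
  by rewrite /= -fe // (allP ed).
- by rewrite cycle_map; apply: sub_cycle hc => p q /fl/and3P[].
- rewrite pairwise_map; apply/(sub_in_pairwise _ Pc pw) => p q.
  by rewrite !unfold_in /= /apart /= => /andP[P1 P2] /andP[P3 P4]; rewrite !fe.
Qed.

(** * Occurrences and contexts *)

Section Substitution.
Variable Sg : signature.
Implicit Types (s : subst Sg) (t : term Sg) (a : atom Sg).

Lemma tsubst_ext s s' t : {in tvars t, s =1 s'} -> tsubst s t = tsubst s' t.
Proof.
elim/term_induction: t => [x | f ts IH] /= ext; first by apply: ext; rewrite mem_head.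
congr Fn; apply/ffunP=> i; rewrite !ffunE; apply: IH => x xi; apply: ext.
by apply/flatten_mapP; exists i; rewrite ?mem_enum.
Qed.

Lemma tsubst_comp s s' t : tsubst s (tsubst s' t) = tsubst (fun x => tsubst s (s' x)) t.
Proof.
elim/term_induction: t => [//|f ts IH] /=.
by congr Fn; apply/ffunP=> i; rewrite !ffunE.
Qed.

Lemma tsubst_id t : tsubst Var t = t.
Proof.
elim/term_induction: t => [//|f ts IH] /=.
by congr Fn; apply/ffunP=> i; rewrite !ffunE.
Qed.

Lemma tvars_tsubst s t y : y \in tvars (tsubst s t) -> exists2 x, x \in tvars t & y \in tvars (s x).
Proof.
elim/term_induction: t => [x | f ts IH] /=; first by exists x; rewrite ?mem_head.
case/flatten_mapP=> i _; rewrite ffunE => /IH[x xi yx].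
by exists x => //; apply/flatten_mapP; exists i; rewrite ?mem_enum.
Qed.

Lemma mem_tvars_tsubst s t x y :
  x \in tvars t -> y \in tvars (s x) -> y \in tvars (tsubst s t).
Proof.
elim/term_induction: t => [z | f ts IH] /=; first by rewrite inE => /eqP->.
case/flatten_mapP=> i _ xi yx; apply/flatten_mapP; exists i; rewrite ?mem_enum //.
by rewrite ffunE; apply: IH.
Qed.

Lemma asubst_ext s s' a : {in avars a, s =1 s'} -> asubst s a = asubst s' a.
Proof.
case: a => //= b p ts ext; congr Pred; apply/ffunP=> i; rewrite !ffunE.
by apply: tsubst_ext => x xi; apply: ext; apply/flatten_mapP; exists i; rewrite ?mem_enum.
Qed.

Lemma asubst_comp s s' a : asubst s (asubst s' a) = asubst (fun x => tsubst s (s' x)) a.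
Proof.
case: a => //= b p ts; congr Pred; apply/ffunP=> i; rewrite !ffunE; exact: tsubst_comp.
Qed.

Lemma asubst_id a : asubst Var a = a.
Proof. by case: a => //= b p ts; congr Pred; apply/ffunP=> i; rewrite !ffunE tsubst_id. Qed.

Lemma asubst_single_notin x t a : x \notin avars a -> asubst (single x t) a = a.
Proof.
move=> xa; rewrite -[RHS]asubst_id; apply: asubst_ext => y ya; rewrite /single /=.
by case: eqVneq => // yx; rewrite -yx ya in xa.
Qed.

Lemma adualK a : adual (adual a) = a.
Proof. by case: a => //= b p ts; rewrite negbK. Qed.

Lemma asubst_adual s a : asubst s (adual a) = adual (asubst s a).
Proof. by case: a. Qed.

Definition lsubst s (l : var + atom Sg) : var + atom Sg :=
  match l with inl x => inl x | inr a => inr (asubst s a) end.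

Lemma lsubst_id l : lsubst Var l = l.
Proof. by case: l => //= a; rewrite asubst_id. Qed.

End Substitution.

Section Occurrences.
Variable Sg : signature.
Implicit Types (A B C : formula Sg) (K : context Sg) (s : subst Sg).

Notation lbl := (label (graph _)).

(* The edges of the fograph, with a loop at each existential binder: several
   dependencies of one existential binder are thus treated as if they were
   attached to distinct, pairwise adjacent copies of it. *)
Fixpoint loop_edge A : rel (occ A) :=
  match A return rel (occ A) with
  | Atom _ => fun _ _ => false
  | And A B => fun u v =>
      match u, v with
      | inl u, inl v => @loop_edge A u v
      | inr u, inr v => @loop_edge B u v
      | _, _ => true
      end
  | Or A B => fun u v =>
      match u, v with
      | inl u, inl v => @loop_edge A u v
      | inr u, inr v => @loop_edge B u v
      | _, _ => false
      end
  | Ex _ A => fun u v =>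
      match u, v with
      | inr u, inr v => @loop_edge A u v
      | _, _ => true
      end
  | All _ A => fun u v =>
      match u, v with
      | inr u, inr v => @loop_edge A u v
      | _, _ => false
      end
  end.
Arguments loop_edge {A} u v.

(** The loops double as a mark of the existential binders: no other occurrence has one. *)
Definition exq A (u : occ A) := loop_edge u u.

Lemma loop_edge_sym A : symmetric (@loop_edge A).
Proof.
elim: A => [a | A IHA B IHB | A IHA B IHB | x A IH | x A IH] //=;
  by [move=> [u|u] [v|v] | case=> u; case=> v].
Qed.

Lemma edgeE A (u v : occ A) : edge (graph A) u v = (u != v) && loop_edge u v.
Proof.
elim: A u v => [a | A IHA B IHB | A IHA B IHB | x A IH | x A IH] /=.
- by [].
- by case=> u; case=> v //=; rewrite ?IHA ?IHB.
- by case=> u; case=> v //=; rewrite ?IHA ?IHB // andbF.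
- by case=> u; case=> v //=; rewrite ?IH //; case: u; case: v.
- by case=> u; case=> v //=; rewrite ?IH ?andbF.
Qed.

Lemma label_bvars A (u : occ A) x : lbl u = inl x -> x \in bvars A.
Proof.
elim: A u => [a | A IHA B IHB | A IHA B IHB | y A IH | y A IH] //=.
- by case=> u ux; rewrite mem_cat ?(IHA u) ?(IHB u) ?orbT.
- by case=> u ux; rewrite mem_cat ?(IHA u) ?(IHB u) ?orbT.
- by case=> u; rewrite inE; [case=> -> | move/IH->]; rewrite ?eqxx ?orbT.
- by case=> u; rewrite inE; [case=> -> | move/IH->]; rewrite ?eqxx ?orbT.
Qed.

Lemma bvars_label A x : x \in bvars A -> exists u : occ A, lbl u = inl x.
Proof.
elim: A => [a | A IHA B IHB | A IHA B IHB | y A IH | y A IH] //=.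
- by rewrite mem_cat => /orP[/IHA|/IHB] [u ux]; [exists (inl u) | exists (inr u)].
- by rewrite mem_cat => /orP[/IHA|/IHB] [u ux]; [exists (inl u) | exists (inr u)].
- by rewrite inE => /predU1P[->|/IH[u ux]]; [exists (inl tt) | exists (inr u)].
- by rewrite inE => /predU1P[->|/IH[u ux]]; [exists (inl tt) | exists (inr u)].
Qed.

Lemma uniq_bvars_label A (u v : occ A) x :
  uniq (bvars A) -> lbl u = inl x -> lbl v = inl x -> u = v.
Proof.
elim: A u v => [a | A IHA B IHB | A IHA B IHB | y A IH | y A IH] //=.
1,2: rewrite cat_uniq => u v /and3P[uA /hasPn dAB uB].
1,2: case: u v => u [v|v] ux vx; first [by rewrite (IHA u v) | by rewrite (IHB u v) |
  by move: (dAB _ (label_bvars vx)); rewrite /= (label_bvars ux) |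
  by move: (dAB _ (label_bvars ux)); rewrite /= (label_bvars vx)].
all: move=> u v /andP[yA uA]; case: u v => [[]|u] [[]|v] // ux vx; first [by rewrite (IH u v) |
  by case: ux => yx; move: yA; rewrite yx (label_bvars vx) |
  by case: vx => yx; move: yA; rewrite yx (label_bvars ux)].
Qed.

Definition lab_is x (l : var + atom Sg) := if l is inl y then y == x else false.

Lemma lab_isP x l : reflect (l = inl x) (lab_is x l).
Proof. by case: l => [y|a] /=; [apply: (iffP eqP) => [->|[]] | constructor]. Qed.

Definition exvar A x := [exists u : occ A, exq u && lab_is x (lbl u)].

Lemma exvarP A x : reflect (exists2 u : occ A, exq u & lbl u = inl x) (exvar A x).
Proof.
by apply: (iffP existsP) => [[u /andP[? /lab_isP]]|[u ? /lab_isP]]; exists u => //; apply/andP.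
Qed.

Lemma exvar_bvars A x : exvar A x -> x \in bvars A.
Proof. by case/exvarP=> u _; apply: label_bvars. Qed.

Lemma atom_var A (u : occ A) a x :
  lbl u = inr a -> x \in avars a -> (x \in fvars A) || (x \in bvars A).
Proof.
elim: A u => [b | A IHA B IHB | A IHA B IHB | y A IH | y A IH] /=.
- by move=> _ [->] ->.
1,2: by rewrite !mem_cat; case=> u ua /[dup] xa; first [move/(IHA _ ua) | move/(IHB _ ua)];
  case/orP=> ->; rewrite ?orbT.
all: case=> u // ua xa; rewrite mem_filter inE; case: eqVneq => //= _; exact: IH ua xa.
Qed.

Lemma exists_literal A : exists (u : occ A) a, lbl u = inr a.
Proof.
elim: A => [a | A [u [a ua]] B _ | A [u [a ua]] B _ | y A [u [a ua]] | y A [u [a ua]]].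
- by exists tt, a.
- by exists (inl u), a.
- by exists (inl u), a.
- by exists (inr u), a.
- by exists (inr u), a.
Qed.

(** Occurrences outside the hole, given independently of its content, so that one [c] denotes an
    occurrence both in the premise and in the conclusion of a step. *)
Fixpoint cocc K : finType :=
  match K with
  | Hole => void
  | AndL K B | OrL K B => (cocc K + occ B)%type
  | AndR B K | OrR B K => (occ B + cocc K)%type
  | ExC _ K | AllC _ K => (unit + cocc K)%type
  end.

Fixpoint inC K A : cocc K -> occ (plug K A) :=
  match K return cocc K -> occ (plug K A) with
  | Hole => fun c => match c with end
  | AndL K B | OrL K B => sum_map (@inC K A) id
  | AndR B K | OrR B K => sum_map id (@inC K A)
  | ExC _ K | AllC _ K => sum_map id (@inC K A)
  end.

Fixpoint inH K A : occ A -> occ (plug K A) :=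
  match K return occ A -> occ (plug K A) with
  | Hole => id
  | AndL K B | OrL K B => fun u => inl (@inH K A u)
  | AndR B K | OrR B K => fun u => inr (@inH K A u)
  | ExC _ K | AllC _ K => fun u => inr (@inH K A u)
  end.

Variant occ_plug_spec K A : occ (plug K A) -> Prop :=
| OccContext c : occ_plug_spec (inC A c)
| OccHole w : occ_plug_spec (@inH K A w).

Lemma occ_plugP K A (u : occ (plug K A)) : occ_plug_spec u.
Proof.
elim: K u => [|K IH B|B K IH|K IH B|B K IH|x K IH|x K IH] /=.
- by move=> u; exact (@OccHole (Hole Sg) A u).
- case=> u; last exact (@OccContext (AndL K B) A (inr u)).
  by case: {u}(IH u) => v; [exact (@OccContext (AndL K B) A (inl v)) | exact (@OccHole (AndL K B) A v)].
- case=> u; first exact (@OccContext (AndR B K) A (inl u)).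
  by case: {u}(IH u) => v; [exact (@OccContext (AndR B K) A (inr v)) | exact (@OccHole (AndR B K) A v)].
- case=> u; last exact (@OccContext (OrL K B) A (inr u)).
  by case: {u}(IH u) => v; [exact (@OccContext (OrL K B) A (inl v)) | exact (@OccHole (OrL K B) A v)].
- case=> u; first exact (@OccContext (OrR B K) A (inl u)).
  by case: {u}(IH u) => v; [exact (@OccContext (OrR B K) A (inr v)) | exact (@OccHole (OrR B K) A v)].
- case=> u; first exact (@OccContext (ExC x K) A (inl u)).
  by case: {u}(IH u) => v; [exact (@OccContext (ExC x K) A (inr v)) | exact (@OccHole (ExC x K) A v)].
- case=> u; first exact (@OccContext (AllC x K) A (inl u)).
  by case: {u}(IH u) => v; [exact (@OccContext (AllC x K) A (inr v)) | exact (@OccHole (AllC x K) A v)].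
Qed.

Lemma loop_edge_inH K A (u v : occ A) : loop_edge (inH K u) (inH K v) = loop_edge u v.
Proof. by elim: K. Qed.

Lemma loop_edge_inC K A B (c d : cocc K) :
  loop_edge (inC A c) (inC A d) = loop_edge (inC B c) (inC B d).
Proof.
elim: K c d => [|K IH D|D K IH|K IH D|D K IH|x K IH|x K IH] //=;
  by case=> c //; case=> d //; apply: IH.
Qed.

(** The hole is a module: adjacency to an occurrence in it is decided at a connective or quantifier
    of the context, whatever fills the hole. *)
Lemma loop_edge_inCH K A B (c : cocc K) (u : occ A) (v : occ B) :
  loop_edge (inC A c) (inH K u) = loop_edge (inC B c) (inH K v).
Proof.
by elim: K c => [|K IH D|D K IH|K IH D|D K IH|x K IH|x K IH] //=; case=> c //; apply: IH.
Qed.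

Lemma label_inH K A (u : occ A) : lbl (inH K u) = lbl u.
Proof. by elim: K. Qed.

Lemma label_inC K A B (c : cocc K) : lbl (inC A c) = lbl (inC B c).
Proof.
by elim: K c => [|K IH D|D K IH|K IH D|D K IH|x K IH|x K IH] //=; case=> c //; apply: IH.
Qed.

Lemma inH_inj K A : injective (@inH K A).
Proof. by elim: K => [|K IH D|D K IH|K IH D|D K IH|x K IH|x K IH] //= u v [] /IH. Qed.

Lemma inC_inj K A B (c d : cocc K) : inC A c = inC A d -> inC B c = inC B d.
Proof.
elim: K c d => [|K IH D|D K IH|K IH D|D K IH|x K IH|x K IH] //=.
all: by case=> c; case=> d //= []; first [by move=> -> | by move/IH=> ->].
Qed.

Lemma inC_inH K A (c : cocc K) (u : occ A) : inC A c <> inH K u.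
Proof.
elim: K c => [|K IH D|D K IH|K IH D|D K IH|x K IH|x K IH] //=.
all: by case=> c //= [] /IH.
Qed.

Lemma plug_trace_inH K A B (f : occ A -> origin (occ B)) u :
  plug_trace f (inH K u) = origin_map (@inH K B) (f u).
Proof.
by elim: K => [|K IH D|D K IH|K IH D|D K IH|x K IH|x K IH] //=; rewrite ?IH; case: (f u).
Qed.

Lemma plug_trace_inC K A B (f : occ A -> origin (occ B)) c :
  plug_trace f (@inC K A c) = Premise (inC B c).
Proof.
elim: K c => [|K IH D|D K IH|K IH D|D K IH|x K IH|x K IH] //=.
all: by case=> c //=; rewrite IH.
Qed.

(* The quantifiers of the context that have the hole in their scope. *)
Fixpoint spine K : cocc K -> bool :=
  match K return cocc K -> bool with
  | Hole => fun _ => false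
  | AndL K B | OrL K B => fun c => if c is inl c then @spine K c else false
  | AndR B K | OrR B K => fun c => if c is inr c then @spine K c else false
  | ExC _ K | AllC _ K => fun c => if c is inr c then @spine K c else true
  end.

Lemma spine_var K C v :
  v \in fvars C -> v \notin fvars (plug K C) -> exists2 c, @spine K c & lbl (inC C c) = inl v.
Proof.
elim: K => [|K IH D|D K IH|K IH D|D K IH|x K IH|x K IH] /= vC.
1: by rewrite vC.
1,3: rewrite mem_cat negb_or => /andP[/(IH vC)[c cs cv] _]; by exists (inl c).
1,2: rewrite mem_cat negb_or => /andP[_ /(IH vC)[c cs cv]]; by exists (inr c).
all: rewrite mem_filter; case: eqVneq => [-> _|_ /=]; first by exists (inl tt).
all: by case/(IH vC)=> c cs cv; exists (inr c).
Qed.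

Lemma spine_hole K A (c : cocc K) (w : occ A) :
  spine c -> loop_edge (inC A c) (inH K w) = exq (inC A c).
Proof.
rewrite /exq; elim: K c => [|K IH D|D K IH|K IH D|D K IH|x K IH|x K IH] //=;
  by case=> c //=; apply: IH.
Qed.

(** If [d] lies under the quantifier [c], then [c] is adjacent to it. Otherwise [c] and the hole are
    on the same side of the point where [d] parts from them, and [d] sees [c] as it sees the
    hole. *)
Lemma spine_ex_adj K A (c d : cocc K) (w : occ A) :
  spine c -> exq (inC A c) -> loop_edge (inC A d) (inH K w) ->
  loop_edge (inC A c) (inC A d).
Proof.
rewrite /exq; elim: K c d => [|K IH D|D K IH|K IH D|D K IH|x K IH|x K IH] //=.
all: by case=> c; case=> d //=; first [exact: IH | rewrite loop_edge_sym; apply: IH].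
Qed.

(** An occurrence outside the subformula quantified by [c] sees all of this subformula as it sees
    the hole. So [d], adjacent to [c] but not to the hole, lies inside; then [d'], adjacent to [d]
    but not to the hole, lies inside too. *)
Lemma spine_ex_path K A (c d d' : cocc K) (w : occ A) :
  spine c -> exq (inC A c) ->
  ~~ loop_edge (inC A d) (inH K w) -> ~~ loop_edge (inC A d') (inH K w) ->
  loop_edge (inC A d) (inC A d') -> loop_edge (inC A c) (inC A d) ->
  loop_edge (inC A c) (inC A d').
Proof.
rewrite /exq; elim: K c d d' => [|K IH D|D K IH|K IH D|D K IH|x K IH|x K IH] //=.
all: by case=> c; case=> d; case=> d' //=; exact: IH.
Qed.

(** A universal [c] is adjacent to nothing under it, so [d] lies outside and sees the hole as it
    sees [c]. *)
Lemma spine_all_adj K A (c d : cocc K) (w : occ A) :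
  spine c -> ~~ exq (inC A c) -> loop_edge (inC A c) (inC A d) ->
  loop_edge (inC A d) (inH K w).
Proof.
rewrite /exq; elim: K c d => [|K IH D|D K IH|K IH D|D K IH|x K IH|x K IH] //=.
all: by case=> c; case=> d //=; exact: IH.
Qed.

Lemma uniq_bvars_plug K C : uniq (bvars (plug K C)) -> uniq (bvars C).
Proof.
elim: K => [|K IH D|D K IH|K IH D|D K IH|x K IH|x K IH] //=.
1,3: by rewrite cat_uniq => /and3P[/IH].
1,2: by rewrite cat_uniq => /and3P[_ _ /IH].
all: by case/andP=> _ /IH.
Qed.

Lemma bvars_plug K C x : x \in bvars C -> x \in bvars (plug K C).
Proof.
move=> xC; elim: K => [|K IH D|D K IH|K IH D|D K IH|y K IH|y K IH] //=;
  by rewrite ?mem_cat ?inE IH ?orbT.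
Qed.

(** An occurrence of [x] in an atom of the context would be free in the whole formula or bound in
    the context a second time. Hence the substitution of an [r_ex] instance does not affect the
    labels of the context. *)
Lemma context_atom_var K C c a x :
  uniq (bvars (plug K C)) -> x \in bvars C -> x \notin fvars (plug K C) ->
  lbl (@inC K C c) = inr a -> x \notin avars a.
Proof.
move=> + xC; elim: K c => [|K IH D|D K IH|K IH D|D K IH|y K IH|y K IH] /=.
- by case.
1,3: rewrite cat_uniq mem_cat negb_or; case=> c /and3P[uK /hasPn dis _] /andP[xK xD]; first exact: IH.
1,2: move=> ca; apply/negP=> /(atom_var ca); rewrite (negPf xD) /= => /dis.
1,2: by rewrite /= bvars_plug.
1,2: rewrite cat_uniq mem_cat negb_or; case=> c /and3P[_ /hasPn dis uK] /andP[xD xK]; last exact: IH.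
1,2: move=> ca; apply/negP=> /(atom_var ca); rewrite (negPf xD) /= => xbD.
1,2: by move: (dis x (bvars_plug K xC)); rewrite /= xbD.
all: rewrite mem_filter; case=> c //= /andP[yK uK]; case: eqVneq => [xy|_ /=]; last exact: IH.
all: by rewrite -xy bvars_plug in yK.
Qed.

End Occurrences.
Arguments loop_edge {Sg A} u v.
Arguments lab_is {Sg} x l.

(** * Tracing occurrences *)

Arguments Consumed {T}.
Arguments Introduced {T}.

Section Traces.
Variable Sg : signature.
Implicit Types (A B C : formula Sg) (K : context Sg) (s : subst Sg).

Notation lbl := (label (graph _)).

Lemma eqv_traceP A B (e : eqv A B) : let fg := eqv_trace e in
  [/\ cancel fg.1 fg.2, cancel fg.2 fg.1,
      forall u v, loop_edge (fg.1 u) (fg.1 v) = loop_edge u v &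
      forall u, lbl (fg.1 u) = lbl u].
Proof.
elim: e => {A B} /=.
- by [].
- move=> A B e; case: (eqv_trace e) => f g /= [fK gK le ll]; split=> // u.
    by move=> v; rewrite -{2}[u]gK -{2}[v]gK le.
  by rewrite -{2}[u]gK ll.
- move=> A B C e1 + e2; case: (eqv_trace e1) (eqv_trace e2) => f1 g1 [f2 g2] /=.
  case=> fK1 gK1 le1 ll1 [fK2 gK2 le2 ll2]; split=> [u|u|u v|u] /=.
  + by rewrite fK2 fK1.
  + by rewrite gK1 gK2.
  + by rewrite le2 le1.
  + by rewrite ll2 ll1.
- move=> A A' B B' e1 + e2; case: (eqv_trace e1) (eqv_trace e2) => f1 g1 [f2 g2] /=.
  case=> fK1 gK1 le1 ll1 [fK2 gK2 le2 ll2].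
  split=> [[u|u]|[u|u]|[u|u] [v|v]|[u|u]] //=; by rewrite ?(fK1, gK1, fK2, gK2).
- move=> A A' B B' e1 + e2; case: (eqv_trace e1) (eqv_trace e2) => f1 g1 [f2 g2] /=.
  case=> fK1 gK1 le1 ll1 [fK2 gK2 le2 ll2].
  split=> [[u|u]|[u|u]|[u|u] [v|v]|[u|u]] //=; by rewrite ?(fK1, gK1, fK2, gK2).
- move=> x A A' e; case: (eqv_trace e) => f g /= [fK gK le ll].
  split=> [[u|u]|[u|u]|[u|u] [v|v]|[u|u]] //=; by rewrite ?(fK, gK).
- move=> x A A' e; case: (eqv_trace e) => f g /= [fK gK le ll].
  split=> [[u|u]|[u|u]|[u|u] [v|v]|[u|u]] //=; by rewrite ?(fK, gK).
- by move=> A B; split=> [[u|u]|[u|u]|[u|u] [v|v]|[u|u]].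
- by move=> A B C; split=> [[u|[u|u]]|[[u|u]|u]|[u|[u|u]] [v|[v|v]]|[u|[u|u]]].
- by move=> A B; split=> [[u|u]|[u|u]|[u|u] [v|v]|[u|u]].
- by move=> A B C; split=> [[u|[u|u]]|[[u|u]|u]|[u|[u|u]] [v|[v|v]]|[u|[u|u]]].
- by move=> x y A; split=> [[u|[u|u]]|[u|[u|u]]|[u|[u|u]] [v|[v|v]]|[u|[u|u]]].
- by move=> x y A; split=> [[u|[u|u]]|[u|[u|u]]|[u|[u|u]] [v|[v|v]]|[u|[u|u]]].
- by move=> x A B _; split=> [[u|[u|u]]|[[u|u]|u]|[u|[u|u]] [v|[v|v]]|[u|[u|u]]].
- by move=> x A B _; split=> [[u|[u|u]]|[[u|u]|u]|[u|[u|u]] [v|[v|v]]|[u|[u|u]]].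
Qed.

Lemma label_fsubst_trace s A (u : occ A) :
  (forall y, y \in bvars A -> s y = Var y) ->
  lbl (fsubst_trace s u) = lsubst s (lbl u).
Proof.
have ext (t : subst Sg) y l : t y = Var y -> lsubst [eta t with y |-> Var y] l = lsubst t l.
  case: l => //= a ty; congr inr; apply: asubst_ext => z _ /=.
  by case: eqVneq => // ->.
elim: A s u => [a | A IHA B IHB | A IHA B IHB | y A IH | y A IH] s //=.
1,2: by case=> u sB; [apply: IHA | apply: IHB] => z zB; apply: sB; rewrite mem_cat zB ?orbT.
all: case=> u //= sB; rewrite IH ?ext //; first by apply: sB; rewrite mem_head.
all: by move=> z zA /=; case: eqVneq => [->|_] //; apply: sB; rewrite inE zA orbT.
Qed.

Lemma loop_edge_fsubst_trace s A (u v : occ A) :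
  loop_edge (fsubst_trace s u) (fsubst_trace s v) = loop_edge u v.
Proof.
elim: A s u v => [a | A IHA B IHB | A IHA B IHB | y A IH | y A IH] s //=;
  by case=> u; case=> v /=.
Qed.

Lemma fsubst_trace_inj s A : injective (@fsubst_trace Sg s A).
Proof.
elim: A s => [a | A IHA B IHB | A IHA B IHB | y A IH | y A IH] s //=;
  by case=> u; case=> v //= []; first [move=> -> | move/IHA=> -> | move/IHB=> -> | move/IH=> ->].
Qed.

Lemma fsubst_trace_surj s A v : exists u, @fsubst_trace Sg s A u = v.
Proof.
elim: A s v => [a | A IHA B IHB | A IHA B IHB | y A IH | y A IH] s v /=.
- by exists v.
1,2: by case: v => v; [have [u <-] := IHA _ v; exists (inl u) | have [u <-] := IHB s v; exists (inr u)].
all: by case: v => v; [exists (inl v) | have [u <-] := IH _ v; exists (inr u)].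
Qed.

Lemma fvars_fsubst s A x v :
  x \in fvars A -> free_for (s x) x A -> v \in tvars (s x) -> v \in fvars (fsubst s A).
Proof.
elim: A s => [a | A IHA B IHB | A IHA B IHB | y A IH | y A IH] s /=.
- case: a => //= b p ts /flatten_mapP[i _ xi] _ vx.
  apply/flatten_mapP; exists i; rewrite ?mem_enum // ffunE; exact: mem_tvars_tsubst vx.
1,2: by rewrite !mem_cat => /orP[xA|xB] /andP[fA fB] vx; rewrite ?(IHA s xA fA vx) ?(IHB s xB fB vx) ?orbT.
all: rewrite !mem_filter; case: eqVneq => //= xy xA; rewrite xA /= => /andP[yv fA] vx.
all: have /= := IH [eta s with y |-> Var y]; rewrite (negPf xy) => -> //.
all: by rewrite andbT; apply: contraNneq yv => <-.
Qed.

Lemma rule_label B A (r : rule B A) u v :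
  uniq (bvars A) -> rule_trace r u = Premise v -> lbl v = lsubst (rule_subst r) (lbl u).
Proof.
case: r u v => {B A} [x|a|A|A B C|A B|x t A ft|B A e] u v /=.
- by move=> _; case: u => // u [<-].
- by [].
- by move=> _; case: u => // u [<-]; rewrite lsubst_id.
- by move=> _ [<-]; case: u => [[u|u]|u]; rewrite lsubst_id.
- by move=> _ [<-]; case: u => [u|u]; rewrite lsubst_id.
- case/andP=> xA _; case: u => // u [<-]; apply: label_fsubst_trace => y yA.
  by rewrite /single /=; case: eqVneq yA xA => // -> ->.
- by have [_ _ _ ll] := eqv_traceP e; move=> _ [<-]; rewrite ll lsubst_id.
Qed.

Lemma rule_trace_inj B A (r : rule B A) u u' v :
  rule_trace r u = Premise v -> rule_trace r u' = Premise v -> u = u'.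
Proof.
case: r u u' v => {B A} [x|a|A|A B C|A B|x t A ft|B A e] u u' v //=.
- by case: u u' => u [] u' // [<-] [->].
- by case: u u' => u [] u' // [<-] [->].
- by move=> [<-] []; case: u u' => [[u|u]|u] [[u'|u']|u'] //= [->].
- by move=> [<-] [].
- by case: u u' => u [] u' // [<-] [] /fsubst_trace_inj->.
- by have [fK _ _ _] := eqv_traceP e; move=> [<-] [] /(can_inj fK).
Qed.

Lemma rule_trace_surj B A (r : rule B A) v :
  (exists u, rule_trace r u = Premise v) \/ lbl v = inr ATrue.
Proof.
case: r v => {B A} [x|a|A|A B C|A B|x t A ft|B A e] v /=; try by right.
- by left; exists (inl v).
- by left; exists (sum_assoc v); case: v => [v|[v|v]].
- by left; exists v.
- by left; have [u <-] := fsubst_trace_surj v; exists (inr u).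
- by left; exists ((eqv_trace e).2 v); have [_ gK _ _] := eqv_traceP e; rewrite gK.
Qed.

Lemma rule_introduced B A (r : rule B A) u :
  rule_trace r u = Introduced -> (exists x, lbl u = inl x) \/ lbl u = inr ATrue.
Proof.
case: r u => {B A} [x|a|A|A B C|A B|x t A ft|B A e] //= [] // u _; last by left; exists x.
- by left; exists x.
- by right.
Qed.

Lemma rule_consumed B A (r : rule B A) u :
  rule_trace r u = Consumed -> exists a u1 u2,
    [/\ [/\ u1 != u2, rule_trace r u1 = Consumed & rule_trace r u2 = Consumed],
        lbl u1 = inr a, lbl u2 = inr (adual a) &
        forall u', rule_trace r u' = Consumed -> u' = u1 \/ u' = u2].
Proof.
case: r u => {B A} [x|a|A|A B C|A B|x t A ft|B A e] //=; try by case.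
move=> _ _; exists a, (inl tt), (inr tt); split=> //.
by case=> [[]|[]] _; [left | right].
Qed.

Lemma step_label B A (r : step B A) u v :
  rectified A -> step_trace r u = Premise v -> lbl v = lsubst (step_subst r) (lbl u).
Proof.
move: r u v => [] {B A} K B A r u v /andP[uA /hasPn fA] /=.
case: u / occ_plugP => w.
  rewrite plug_trace_inC => -[<-] {v}; rewrite (label_inC B A w).
  case: r w uA fA => {B A} [x|a|A|A B C|A B|x t A ft|B A e] w uA fA /=; rewrite ?lsubst_id //.
  case lw: (lbl (inC _ w)) => [y|a] //=; rewrite asubst_single_notin //.
  have xA : x \in bvars (Ex x A) by rewrite mem_head.
  by apply: context_atom_var lw => //; apply: fA; apply: bvars_plug.
rewrite plug_trace_inH; case tw: (rule_trace r w) => [w'||] //= [<-].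
by rewrite !label_inH; apply: rule_label tw; apply: uniq_bvars_plug uA.
Qed.

Lemma step_trace_inj B A (r : step B A) u u' v :
  step_trace r u = Premise v -> step_trace r u' = Premise v -> u = u'.
Proof.
case: r u u' v => {B A} K B A r u u' v /=.
case: u / occ_plugP => w; case: u' / occ_plugP => w'; rewrite ?plug_trace_inC ?plug_trace_inH.
- by move=> [<-] [] /esym/inC_inj->.
- by case: (rule_trace r w') => // w'' [<-] [] /esym/inC_inH.
- by case: (rule_trace r w) => // w'' [<-] [] /inC_inH.
case tw: (rule_trace r w) => [w1||] //= [<-].
case tw': (rule_trace r w') => [w1'||] //= [] /inH_inj e1.
by rewrite (rule_trace_inj tw (u' := w')) // tw' e1.
Qed.

Lemma step_trace_surj B A (r : step B A) v : (exists u, step_trace r u = Premise v) \/ lbl v = inr ATrue.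
Proof.
case: r v => {B A} K B A r v /=.
case: v / occ_plugP => w; first by left; exists (inC A w); rewrite plug_trace_inC.
rewrite label_inH; have [[u ru]|] := rule_trace_surj r w; last by right.
by left; exists (inH K u); rewrite plug_trace_inH ru.
Qed.

Lemma step_introduced B A (r : step B A) u :
  step_trace r u = Introduced -> (exists x, lbl u = inl x) \/ lbl u = inr ATrue.
Proof.
case: r u => {B A} K B A r u /=.
case: u / occ_plugP => w; first by rewrite plug_trace_inC.
rewrite plug_trace_inH label_inH.
by case tw: (rule_trace r w) => //= _; apply: rule_introduced tw.
Qed.

Lemma step_consumed B A (r : step B A) u :
  step_trace r u = Consumed -> exists a u1 u2,
    [/\ [/\ u1 != u2, step_trace r u1 = Consumed & step_trace r u2 = Consumed],
        lbl u1 = inr a, lbl u2 = inr (adual a) &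
        forall u', step_trace r u' = Consumed -> u' = u1 \/ u' = u2].
Proof.
case: r u => {B A} K B A r u /=.
case: u / occ_plugP => w; first by rewrite plug_trace_inC.
rewrite plug_trace_inH; case tw: (rule_trace r w) => //= _.
have [a [u1 [u2 [[ne r1 r2] l1 l2 only]]]] := rule_consumed tw.
exists a, (inH K u1), (inH K u2); rewrite !label_inH !plug_trace_inH r1 r2.
split=> //; first by split=> //; apply: contraNneq ne => /inH_inj->.
move=> u'; case: u' / occ_plugP => w'; first by rewrite plug_trace_inC.
by rewrite plug_trace_inH; case tw': (rule_trace r w') => //= _; case: (only _ tw') => ->; [left|right].
Qed.

Lemma step_exq B A (r : step B A) u v : step_trace r u = Premise v -> exq v = exq u.
Proof.
case: r u v => {B A} K B A r u v /=; rewrite /exq.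
case: u / occ_plugP => w; first by rewrite plug_trace_inC => -[<-]; apply: loop_edge_inC.
rewrite plug_trace_inH; case tw: (rule_trace r w) => [w'||] //= [<-] {v}; rewrite !loop_edge_inH.
case: r w w' tw => {B A} [x|a|A|A B C|A B|x t A ft|B A e] /= w w'.
- by case: w => // w [<-].
- by [].
- by case: w => // w [<-].
- by case=> <-; case: w => [[w|w]|w].
- by case=> <-; case: w => [w|w].
- by case: w => // w [<-]; rewrite loop_edge_fsubst_trace.
- by have [_ _ le _] := eqv_traceP e; case=> <-.
Qed.

Lemma step_binder B A (r : step B A) (rA : rectified A) u v x : step_trace r u = Premise v -> (lbl v = inl x <-> lbl u = inl x).
Proof. by move/(step_label rA)->; case: (lbl u) => [y|a] //=; split=> // -[->]. Qed.

Lemma step_exvar B A (r : step B A) (rA : rectified A) x : exvar B x -> exvar A x.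
Proof.
case/exvarP=> v ex vx; have [[u uv]|] := step_trace_surj r v; last by rewrite vx.
by apply/exvarP; exists u; [rewrite -(step_exq uv) | apply/(step_binder rA x uv)].
Qed.

Lemma step_subst_exvar B A (r : step B A) x : ~~ exvar A x -> step_subst r x = Var x.
Proof.
case: r => {B A} K D C [x'|a|A'|A' B' C'|A' B'|x' t A' ft|B' A' e] //= nx.
rewrite /single /=; case: eqVneq nx => // -> /exvarP[].
exists (inH K (inl tt : occ (Ex x' A'))); last by rewrite label_inH.
by rewrite /exq loop_edge_inH.
Qed.

End Traces.

(** * Links and dualizers along a derivation *)

Section Invariant.
Variable Sg : signature.
Implicit Types (A B C : formula Sg) (K : context Sg) (d : subst Sg).

Notation lbl := (label (graph _)).

Definition no_false A := forall u : occ A, lbl u <> inr AFalse.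

Lemma false_free_no_false A : false_free A -> no_false A.
Proof.
elim: A => [[||b p ts] | A IHA B IHB | A IHA B IHB | x A IH | x A IH] //=.
1,2: by case/andP=> /IHA fA /IHB fB; case=> u; [apply: fA | apply: fB].
all: by move/IH=> fA; case=> u //; apply: fA.
Qed.

Lemma consumer_lt B A (Phi : derivation B A) u n : consumer Phi u = Some n -> n < nb_steps Phi.
Proof.
elim: Phi u n => //= {}C {}A Phi IH r u n.
by case: (step_trace r u) => // [v /IH/leqW|[<-]].
Qed.

Lemma rectified_derivationP B A (Phi : derivation B A) :
  rectified_derivation Phi -> rectified A.
Proof. by case: Phi => [|C A' Phi r] /andP[]. Qed.

Lemma literal_consumed A (Phi : derivation ftrue A) u a :
  rectified_derivation Phi -> lbl u = inr a -> a = ATrue \/ isSome (consumer Phi u).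
Proof.
elim: Phi u a => [|C {}A Phi IH r] u a /=; first by move=> _ [<-]; left.
case/andP=> rA rPhi ua; case tu: (step_trace r u) => [v||] /=; last 1 first.
- by case: (step_introduced tu) => [[x]|]; rewrite ua // => -[->]; left.
- have := step_label rA tu; rewrite ua => /(IH _ _ rPhi)[|->]; last by right.
  by case: (a) => // _; left.
- by right.
Qed.

(** The step number identifies the [ai] instance: by [consumer_lt], literals consumed further up
    carry smaller numbers than those consumed by the last step. *)
Lemma consumed_pair A (Phi : derivation ftrue A) u n :
  rectified_derivation Phi -> no_false A -> consumer Phi u = Some n ->
  exists w, [/\ u != w, consumer Phi w = Some n,
    forall w', consumer Phi w' = Some n -> w' = u \/ w' = w &
    forall w', w' = u \/ w' = w -> exists2 a, lbl w' = inr a & a <> ATrue].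
Proof.
elim: Phi u n => [//|C {}A Phi IH r] u n /= /andP[rA rPhi] nfA.
have nfC : no_false C.
  move=> v vF; have [[w wv]|] := step_trace_surj r v; last by rewrite vF.
  have := step_label rA wv; rewrite vF.
  by case lw: (lbl w) => [x|[||b p ts]] //= _; apply: (nfA w).
case tu: (step_trace r u) => [v||] //= cu; last first.
  have [a [u1 [u2 [[ne t1 t2] l1 l2 only]]]] := step_consumed tu.
  (* If one literal of the link were true, its dual would be a false constant, which is excluded. *)
  have aT : a <> ATrue by move=> aT; apply: (nfA u2); rewrite l2 aT.
  have aF : adual a <> ATrue by move=> aF; apply: (nfA u1); rewrite l1 -[a]adualK aF.
  have only' w' : match step_trace r w' with
      | Premise v => consumer Phi v | Consumed => Some (nb_steps Phi) | Introduced => None end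
      = Some n -> step_trace r w' = Consumed.
    case: (step_trace r w') => // v; rewrite -cu => /consumer_lt; by rewrite ltnn.
  case: (only _ tu) => ->; [exists u2 | exists u1].
    rewrite t2; split=> // [w' /only'/only //|w' [] ->].
      by exists a.
    by exists (adual a).
  rewrite t1 eq_sym; split=> // [w' /only'/only|w' [] ->]; first by case; [right|left].
    by exists (adual a).
  by exists a.
have [w [vw cw only lits]] := IH v n rPhi nfC cu.
have [a wa aT] := lits w (or_intror erefl).
have [[w1 tw]|] := step_trace_surj r w; last by rewrite wa => -[].
have back w' v' : step_trace r w' = Premise v' -> forall v'' w'', step_trace r w'' = Premise v'' -> v' = v'' -> w' = w''.
  by move=> t' v'' w'' t'' e; apply: (step_trace_inj t'); rewrite t'' e.
exists w1; rewrite tw cw; split=> //.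
- by apply: contraNneq vw => uw; move: tw; rewrite -uw tu => -[->].
- move=> w'; case tw': (step_trace r w') => [v'||] //=; last first.
    by move=> e; move: (consumer_lt cu); case: e => ->; rewrite ltnn.
  by move/only=> [] e; [left | right]; apply: back tw' _ _ _ e.
have lit w' v' a' : step_trace r w' = Premise v' -> lbl v' = inr a' -> a' <> ATrue ->
    exists2 a, lbl w' = inr a & a <> ATrue.
  move/(step_label rA)=> ->; case: (lbl w') => //= b [<-] bT; exists b => // bE.
  by apply: bT; rewrite bE.
move=> w' [] ->; last exact: lit tw wa aT.
by have [a' va aT'] := lits v (or_introl erefl); exact: lit tu va aT'.
Qed.

(* [d] is a dualizer, the existential binders being read off the formula. *)
Definition dualizes B A (Phi : derivation B A) d :=
  (forall x, ~~ exvar A x -> d x = Var x) /\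
  (forall u v a a', u != v -> same_ai Phi u v -> lbl u = inr a -> lbl v = inr a' ->
     asubst d a' = adual (asubst d a)).

(** This allows the composed dualizer to be exchanged for one without spurious dependencies:
    applying [s] afterwards preserves duality, and only the values on the labels matter. *)
Lemma dualizes_ext B A (Phi : derivation B A) d d' (s : subst Sg) :
  dualizes Phi d -> (forall x, ~~ exvar A x -> d' x = Var x) ->
  (forall (u : occ A) a, lbl u = inr a -> asubst d' a = asubst s (asubst d a)) ->
  dualizes Phi d'.
Proof.
case=> _ dual fix' ext; split=> // u v a a' uv link ua va.
by rewrite (ext _ _ va) (ext _ _ ua) (dual u v a a') // asubst_adual.
Qed.

Lemma dualizes_step C A (Phi : derivation ftrue C) (r : step C A) d :
  rectified A -> dualizes Phi d ->
  dualizes (DStep Phi r) (fun x => tsubst d (step_subst r x)).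
Proof.
move=> rA [fixd dual]; split=> [x nx|u v a a' uv].
  rewrite step_subst_exvar //=; apply: fixd; apply: contra nx; exact: step_exvar.
rewrite /same_ai /=; case tu: (step_trace r u) => [u'||] //=.
  have /= lu := step_label rA tu.
  case tv: (step_trace r v) => [v'||]; last by case: (consumer Phi u').
    have /= lv := step_label rA tv => link ua va; rewrite -!asubst_comp.
    rewrite ua in lu; rewrite va in lv; apply: (dual u' v') => //.
    by apply: contraNneq uv => u'v'; apply/eqP/(step_trace_inj tu); rewrite tv u'v'.
  case cu: (consumer Phi u') => [n|] //= /eqP[nE].
  by have := consumer_lt cu; rewrite nE ltnn.
case tv: (step_trace r v) => [v'||] //=.
  by move/eqP/esym/consumer_lt; rewrite ltnn.
move=> _; have [b [u1 [u2 [_ l1 l2 only]]]] := step_consumed tu.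
move: uv; case: (only _ tu) => ->; case: (only _ tv) => ->; rewrite ?eqxx // l1 l2 => _ [<-] [<-].
  exact: asubst_adual.
by rewrite -asubst_adual adualK.
Qed.

Lemma delta_dualizes A (Phi : derivation ftrue A) :
  rectified_derivation Phi -> dualizes Phi (delta Phi).
Proof.
elim: Phi => [|C {}A Phi IH r] /=; first by [].
by case/andP=> rA /IH; apply: dualizes_step.
Qed.

(** Dependencies with respect to an arbitrary [d] instead of the most general dualizer, and with the
    kind of a binder read off the formula instead of its scope. *)
Definition depends A d (u v : occ A) :=
  [&& exq u, ~~ exq v &
      match lbl u, lbl v with inl x, inl y => y \in tvars (d x) | _, _ => false end].

Definition leaps B A (Phi : derivation B A) d : rel (occ A) := fun u v =>
  [|| (u != v) && same_ai Phi u v, depends d u v | depends d v u].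

Lemma leaps_sym B A (Phi : derivation B A) d : symmetric (leaps Phi d).
Proof.
move=> u v; rewrite /leaps (eq_sym u) [depends d u v || _]orbC /same_ai.
by rewrite (eq_sym (consumer Phi u)); case: (eqVneq (consumer Phi v)) => [->|_]; rewrite ?andbF.
Qed.

Lemma leaps_irr B A (Phi : derivation B A) d u : leaps Phi d u u = false.
Proof. by rewrite /leaps /depends eqxx /=; case: (exq u). Qed.

Lemma leaps_ATrue C A (Phi : derivation ftrue C) (r : step C A) d u v :
  step_trace r u = Introduced -> lbl u = inr ATrue -> ~~ leaps (DStep Phi r) d u v.
Proof.
move=> tu ua; rewrite /leaps /depends /same_ai /= tu ua /=.
by rewrite !andbF; case: (lbl v) => *; rewrite !andbF.
Qed.

Lemma leaps_premise C A (Phi : derivation ftrue C) (r : step C A) dC dA u v u' v' :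
  rectified A -> step_trace r u = Premise u' -> step_trace r v = Premise v' ->
  (forall x y, exvar C x -> y \in bvars A -> y \in tvars (dA x) -> y \in tvars (dC x)) ->
  leaps (DStep Phi r) dA u v -> leaps Phi dC u' v'.
Proof.
move=> rA + + sub; have dep w w1 z z1 : step_trace r w = Premise w1 -> step_trace r z = Premise z1 ->
    depends dA w z -> depends dC w1 z1.
  move=> tw tz; rewrite /depends (step_exq tw) (step_exq tz) (step_label rA tw) (step_label rA tz).
  case wx: (lbl w) => [x|?] //=; case zy: (lbl z) => [y|?] //= /and3P[ew -> yx]; rewrite ew /=.
  apply: sub (label_bvars zy) yx; apply/exvarP; exists w1; first by rewrite (step_exq tw).
  by rewrite (step_label rA tw) wx.
move=> tu tv /or3P[]; rewrite /leaps.
- rewrite /same_ai /= tu tv => /andP[uv ->]; rewrite andbT.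
  suff -> : u' != v' by [].
  by apply: contraNneq uv => u'v'; apply/eqP/(step_trace_inj tu); rewrite tv u'v'.
- by move/(dep _ _ _ _ tu tv)->; rewrite orbT.
- by move/(dep _ _ _ _ tv tu)->; rewrite !orbT.
Qed.

Definition is_premise T (o : origin T) := if o is Premise _ then true else false.

(** [v0] is a mere default, for the occurrences that do not continue in the premise. *)
Definition parent C A (r : step C A) (v0 : occ C) (u : occ A) :=
  if step_trace r u is Premise v then v else v0.

Lemma parentE C A (r : step C A) v0 u :
  is_premise (step_trace r u) -> step_trace r u = Premise (parent r v0 u).
Proof. by rewrite /parent; case: (step_trace r u). Qed.

(** When everything that leaps continues in the premise, cycles are carried upwards along [parent].
    The relation [e] is left open because, for switch and mix, it is the edge relation of the
    conclusion with the deleted edges put back. *)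
Lemma acyclic_premise C A (Phi : derivation ftrue C) (r : step C A) dC dA (e : rel (occ A)) :
  rectified A ->
  (forall x y, exvar C x -> y \in bvars A -> y \in tvars (dA x) -> y \in tvars (dC x)) ->
  (forall u v, leaps (DStep Phi r) dA u v -> is_premise (step_trace r u)) ->
  (forall u v u' v', step_trace r u = Premise u' -> step_trace r v = Premise v' ->
     e u v = loop_edge u' v') ->
  acyclic loop_edge (leaps Phi dC) -> acyclic e (leaps (DStep Phi r) dA).
Proof.
move=> rA sub prem eE; have [v0 _] := exists_literal C.
apply: (@acyclic_map _ _ (parent r v0) (fun u => is_premise (step_trace r u))).
  move=> u v luv; have pu := prem u v luv; have pv : is_premise (step_trace r v).
    by apply: (prem v u); rewrite leaps_sym.
  by rewrite pu pv /=; apply: leaps_premise luv => //; apply: parentE.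
by move=> u v pu pv; apply: eE; apply: parentE.
Qed.

End Invariant.

(** * Preservation of acyclicity *)

Section Preservation.
Variable Sg : signature.
Implicit Types (A B C : formula Sg) (K : context Sg) (d : subst Sg).

Notation lbl := (label (graph _)).

Definition good A (Phi : derivation ftrue A) :=
  exists d, dualizes Phi d /\ acyclic loop_edge (leaps Phi d).

Definition in_hole K A (P : pred (occ A)) : pred (occ (plug K A)) :=
  fun u => [exists w, (u == inH K w) && P w].

Lemma in_hole_inH K A (P : pred (occ A)) w : in_hole P (inH K w) = P w.
Proof.
apply/existsP/idP => [[w' /andP[/eqP/inH_inj-> //]]|Pw].
by exists w; rewrite eqxx.
Qed.

Lemma in_hole_inC K A (P : pred (occ A)) (c : cocc K) : in_hole P (inC A c) = false.
Proof. by apply/existsP=> -[w /andP[/eqP/inC_inH]]. Qed.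

(** The common form of switch, mix and equivalence: each occurrence continues in the premise, where
    all edges between [S] and [U] are added. It is enough to state the conditions on [S] and [U]
    inside the hole, since a context occurrence is adjacent to all of the hole or to none of it. *)
Lemma good_join K A B (r : rule B A) (f : occ A -> occ B) (S U : pred (occ A))
    (Phi : derivation ftrue (plug K B)) :
  rectified (plug K A) -> rule_subst r = Var ->
  (forall u, rule_trace r u = Premise (f u)) ->
  (forall a b, loop_edge (f a) (f b) = [|| loop_edge a b, S a && U b | S b && U a]) ->
  (forall a u, S a -> U u -> (a != u) && ~~ loop_edge a u) ->
  (forall a b z, S a -> S b -> ~~ S z -> loop_edge a z -> loop_edge b z) ->
  (forall a u z, S a -> U u -> ~~ U z -> loop_edge u z -> loop_edge a z) ->
  good Phi -> good (DStep Phi (Step K r)).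
Proof.
move=> rA rVar tr edges SU modS modU [d [dd acy]]; exists d; split.
  by have := dualizes_step (Step K r) rA dd; rewrite /= rVar.
have [v0 _] := exists_literal (plug K B).
have tC c : step_trace (Step K r) (inC A c) = Premise (inC B c) by rewrite /= plug_trace_inC.
have tH w : step_trace (Step K r) (inH K w) = Premise (inH K (f w)) by rewrite /= plug_trace_inH tr.
pose e' u v := loop_edge (parent (Step K r) v0 u) (parent (Step K r) v0 v).
apply: (@acyclic_join _ _ e' _ (in_hole S) (in_hole U)).
- exact: loop_edge_sym.
- exact: leaps_sym.
- move=> a b; rewrite /e' /parent.
  case: a / occ_plugP => a; case: b / occ_plugP => b;
    rewrite ?tC ?tH ?in_hole_inH ?in_hole_inC ?andbF /= ?orbF ?loop_edge_inH //.
  + exact: loop_edge_inC.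
  + exact: loop_edge_inCH.
  + by rewrite loop_edge_sym [RHS]loop_edge_sym; apply: loop_edge_inCH.
- move=> a u; case: a / occ_plugP => a; case: u / occ_plugP => u; rewrite ?in_hole_inC ?in_hole_inH //.
  by rewrite loop_edge_inH (inj_eq (@inH_inj _ _ _)); apply: SU.
- move=> a b z; case: a / occ_plugP => a; case: b / occ_plugP => b; case: z / occ_plugP => z;
    rewrite ?in_hole_inC ?in_hole_inH ?loop_edge_inH //; last exact: modS.
  by move=> _ _ _; rewrite ![loop_edge (inH K _) _]loop_edge_sym (loop_edge_inCH z a b).
- move=> a u z; case: a / occ_plugP => a; case: u / occ_plugP => u; case: z / occ_plugP => z;
    rewrite ?in_hole_inC ?in_hole_inH ?loop_edge_inH //; last exact: modU.
  by move=> _ _ _; rewrite ![loop_edge (inH K _) _]loop_edge_sym (loop_edge_inCH z a u).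
apply: acyclic_premise acy => //.
- by move=> u v _; case: u / occ_plugP => u; rewrite ?tC ?tH.
- by move=> u v u' v' tu tv; rewrite /e' /parent tu tv.
Qed.

Lemma good_mix K A B (Phi : derivation ftrue (plug K (And A B))) :
  rectified (plug K (Or A B)) -> good Phi -> good (DStep Phi (Step K (r_mix A B))).
Proof.
move=> rA; apply: (@good_join K (Or A B) _ (r_mix A B) id
  (fun u => if u is inl _ then true else false) (fun u => if u is inr _ then true else false)) => //.
- by case=> a; case=> b /=; rewrite ?orbF ?orbT.
- by case=> a; case=> u.
- by case=> a; case=> b; case=> z.
- by case=> a; case=> u; case=> z.
Qed.

(** The premise has the additional edges between [A] and [C]. In the conclusion, [B] is joined to
    all of [A], and no edge leaves [C] within the hole. *)
Lemma good_s K A B C (Phi : derivation ftrue (plug K (And A (Or B C)))) :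
  rectified (plug K (Or (And A B) C)) -> good Phi -> good (DStep Phi (Step K (r_s A B C))).
Proof.
move=> rA; apply: (@good_join K (Or (And A B) C) _ (r_s A B C) (@sum_assocV _ _ _)
  (fun u => if u is inl (inl _) then true else false) (fun u => if u is inr _ then true else false)) => //.
- by case=> [[a|a]|a] [[b|b]|b] /=; rewrite ?orbF ?orbT.
- by case=> [[a|a]|a] [[u|u]|u].
- by case=> [[a|a]|a] [[b|b]|b] [[z|z]|z].
- by case=> [[a|a]|a] [[b|b]|b] [[z|z]|z].
Qed.

Lemma good_eqv K A B (e : eqv A B) (Phi : derivation ftrue (plug K B)) :
  rectified (plug K A) -> good Phi -> good (DStep Phi (Step K (r_eqv e))).
Proof.
have [_ _ le _] := eqv_traceP e.
move=> rA; apply: (@good_join K A _ (r_eqv e) (eqv_trace e).1 pred0 pred0) => //.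
by move=> a b; rewrite le !orbF.
Qed.

Lemma good_t K A (Phi : derivation ftrue (plug K A)) :
  rectified (plug K (And A ftrue)) -> good Phi -> good (DStep Phi (Step K (r_t A))).
Proof.
move=> rA [d [dd acy]]; exists d; split; first exact: (dualizes_step (Step K (r_t A)) rA dd).
apply: acyclic_premise acy => //.
- move=> u v; case tu: (step_trace _ u) => [u'||] //.
    by move: tu; case: u / occ_plugP => w /=; rewrite ?plug_trace_inC ?plug_trace_inH //; case: w.
  case: (step_introduced tu) => [[x ux]|ua]; last by rewrite (negPf (leaps_ATrue _ _ _ tu ua)).
  move: tu ux; case: u / occ_plugP => w /=; rewrite ?plug_trace_inC ?plug_trace_inH ?label_inH //.
  by case: w.
- move=> u v u' v' /=; case: u / occ_plugP => u; case: v / occ_plugP => v;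
  rewrite ?plug_trace_inC ?plug_trace_inH; try case: u => u //; try case: v => v //;
  move=> [<-] [<-]; rewrite ?loop_edge_inH //.
  + exact: loop_edge_inC.
  + exact: loop_edge_inCH.
  + by rewrite loop_edge_sym [RHS]loop_edge_sym; apply: loop_edge_inCH.
Qed.

Lemma fresh (s : seq nat) : exists w, w \notin s.
Proof.
exists (\max_(x <- s) x).+1; apply/negP=> ws.
by have := @leq_bigmax_seq _ s xpredT id _ ws isT; rewrite ltnn.
Qed.

Lemma rectified_binder_atom K C x (u : occ (plug K C)) a :
  rectified (plug K C) -> x \in bvars C -> (forall w b, lbl (w : occ C) = inr b -> x \notin avars b) ->
  lbl u = inr a -> x \notin avars a.
Proof.
case/andP=> uA /hasPn fA xC Catoms; case: u / occ_plugP => w.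
  move=> wa; exact: context_atom_var uA xC (fA _ (bvars_plug K xC)) wa.
by rewrite label_inH; apply: Catoms.
Qed.

(* Any dependency on the new universal binder is removed by renaming the
   variable in the dualizer. *)
Lemma good_all K x (Phi : derivation ftrue (plug K ftrue)) :
  rectified (plug K (All x ftrue)) -> good Phi -> good (DStep Phi (Step K (r_all Sg x))).
Proof.
move=> rA [d [dd acy]].
(* No binder of the conclusion is labelled [w], so once [x] is renamed to [w] in the values of [d],
   its occurrences there give no dependency. *)
have [w wA] := fresh (bvars (plug K (@All Sg x ftrue))).
have xA : x \in bvars (plug K (@All Sg x ftrue)) by apply: bvars_plug; rewrite mem_head.
have xw : x != w by apply: contraNneq wA => <-.
pose ren := single x (Var w : term Sg).
pose d' z := if exvar (plug K ftrue) z then tsubst ren (d z) else Var z.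
have dd' := dualizes_step (Step K (r_all Sg x)) rA dd.
exists d'; split.
  apply: (dualizes_ext (s := ren) dd').
    move=> z nz; rewrite /d' ifN //; apply: contra nz => /(step_exvar (Step K (r_all Sg x)) rA).
    by [].
  move=> u a ua; rewrite asubst_comp; apply: asubst_ext => z za /=.
  rewrite /d'; case: ifPn => // nz; rewrite (proj1 dd _ nz) /= /ren /single /=.
  case: eqVneq => // zx; suff : x \notin avars a by rewrite -zx za.
  apply: (rectified_binder_atom rA _ _ ua); first by rewrite mem_head.
  by case=> // -[] b /= [<-].
apply: acyclic_premise acy => //.
- move=> z y ez yA; rewrite /d' ez => /tvars_tsubst[y' y'd].
  rewrite /ren /single /=; case: eqVneq => [_|_]; rewrite inE => /eqP yE; last by rewrite yE.
  by move: wA; rewrite -yE yA.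
- move=> u v; case tu: (step_trace _ u) => [u'||] //.
    by move: tu; case: u / occ_plugP => z /=; rewrite ?plug_trace_inC ?plug_trace_inH //; case: z.
  case: (step_introduced tu) => [[y ux]|ua]; last by rewrite (negPf (leaps_ATrue _ _ _ tu ua)).
  rewrite /leaps /same_ai /= in tu *; rewrite tu andbF /=.
  have [ueq yx]: u = inH K (inl tt : occ (All x ftrue)) /\ y = x.
    move: tu ux; case: u / occ_plugP => z /=; rewrite ?plug_trace_inC ?plug_trace_inH ?label_inH //.
    by case: z => [[]|[]] //= _ [].
  have nu : exq u = false by rewrite ueq /exq loop_edge_inH.
  rewrite /depends nu /= ux; case vz: (lbl v) => [z|?]; rewrite ?andbF // yx => /andP[ev].
  rewrite /d'; case: ifP => [_ /tvars_tsubst[y' _]|_]; last first.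
    rewrite inE => /eqP xz; move: ev; rewrite (uniq_bvars_label (proj1 (andP rA)) vz (v := u)) ?nu //.
    by rewrite ux yx xz.
  rewrite /ren /single /=; case: eqVneq => [_|/negPf ne]; rewrite inE ?(negPf xw) // eq_sym ne. by [].
- move=> u v u' v' /=; case: u / occ_plugP => u; case: v / occ_plugP => v;
  rewrite ?plug_trace_inC ?plug_trace_inH; try case: u => u //; try case: v => v //;
  move=> [<-] [<-]; rewrite ?loop_edge_inH //.
  + exact: loop_edge_inC.
  + exact: loop_edge_inCH.
  + by rewrite loop_edge_sym [RHS]loop_edge_sym; apply: loop_edge_inCH.
Qed.
End Preservation.

Section LinkAndWitness.
Variable Sg : signature.
Implicit Types (A B C : formula Sg) (K : context Sg) (d : subst Sg).

Notation lbl := (label (graph _)).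

Lemma leaps_consumed C A (Phi : derivation ftrue C) (r : step C A) d u v :
  step_trace r u = Consumed -> leaps (DStep Phi r) d u v -> step_trace r v = Consumed.
Proof.
move=> tu; have [b [u1 [u2 [_ l1 l2 only]]]] := step_consumed tu.
have [a ua] : exists a, lbl u = inr a by case: (only _ tu) => ->; [exists b | exists (adual b)].
rewrite /leaps /depends ua !andbF orFb => /orP[|/and3P[_ _]]; last by case: (lbl v).
rewrite /same_ai /= tu /= => /andP[_]; case tv: (step_trace r v) => [v'||] //= /eqP/esym/consumer_lt.
by rewrite ltnn.
Qed.

(* A literal of the new link can only leap to its dual, and the partner of one
   in the cycle is adjacent to both. *)
Lemma good_ai K a (Phi : derivation ftrue (plug K ftrue)) :
  rectified (plug K (Or (Atom a) (Atom (adual a)))) -> good Phi ->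
  good (DStep Phi (Step K (r_ai a))).
Proof.
move=> rA [d [dd acy]]; exists d; split; first exact: (dualizes_step (Step K (r_ai a)) rA dd).
set r := Step K (r_ai a); have [v0 _] := exists_literal (plug K (@ftrue Sg)).
have holeP u : step_trace r u = Consumed -> exists w, u = inH K (w : occ (Or _ _)).
  by case: u / occ_plugP => w; [rewrite /= plug_trace_inC | exists w].
have flat (w w' : occ (Or (Atom a) (Atom (adual a)))) : loop_edge w w' = false.
  by case: w => w; case: w'.
have premise u : step_trace r u <> Consumed -> is_premise (step_trace r u).
  by case: u / occ_plugP => w; rewrite /= ?plug_trace_inC ?plug_trace_inH.
apply: (@acyclic_restrict _ _ _ (fun u v => is_premise (step_trace r u) && is_premise (step_trace r v))).
  move=> c p q altc pc qc lpq.
  have np : step_trace r p.2 <> Consumed.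
    move=> tp; have tq := leaps_consumed tp lpq.
    have [w pw] := holeP _ tp; have [w' qw'] := holeP _ tq.
    have := alternating_edge altc pc; rewrite pw; case pE: _ / (occ_plugP p.1) => [k|w1]; last first.
      by rewrite loop_edge_inH flat.
    have pq : p != q by apply/eqP=> pq; move: qw'; rewrite -pq pE => /inC_inH.
    have := alternating_apart (@loop_edge_sym _ _) altc pc qc pq.
    by rewrite /apart pE qw' (loop_edge_inCH k w' w) => /norP[/negPf->].
  rewrite (premise _ np) premise // => tq; apply: np.
  by apply: leaps_consumed tq _; rewrite leaps_sym; apply: lpq.
apply: (acyclic_map (f := parent r v0) (P := fun u => is_premise (step_trace r u))) acy.
  move=> u v /andP[lp /andP[pu pv]].
  by rewrite pu pv /=; apply: leaps_premise lp => //; apply: parentE.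
move=> u v /(parentE v0) + /(parentE v0).
move: (parent r v0 u) (parent r v0 v) => u' v' /=.
case: u / occ_plugP => u; case: v / occ_plugP => v; rewrite ?plug_trace_inC ?plug_trace_inH //.
by move=> [<-] [<-]; apply: loop_edge_inC.
Qed.

(** * Instances of the existential rule *)

Section Exists.
Variables (K : context Sg) (x : nat) (t : term Sg) (A0 : formula Sg).
Hypothesis ft : free_for t x A0.
Let A := plug K (Ex x A0).
Let B := plug K (fsubst (single x t) A0).
Let r : step B A := Step K (r_ex ft).
Variable Phi : derivation ftrue B.
Hypotheses (rA : rectified A) (rB : rectified B).
Let X : occ A := inH K (inl tt : occ (Ex x A0)).

Let tX : step_trace r X = Introduced.
Proof. by rewrite /= plug_trace_inH. Qed.

Let tC c : step_trace r (inC (Ex x A0) c) = Premise (inC _ c).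
Proof. by rewrite /= plug_trace_inC. Qed.

Let tH w : step_trace r (inH K (inr w : occ (Ex x A0))) = Premise (inH K (fsubst_trace (single x t) w)).
Proof. by rewrite /= plug_trace_inH. Qed.

Let cX : consumer (DStep Phi r) X = None.
Proof. by have /= -> := tX. Qed.

Let lX : lbl X = inl x.
Proof. by rewrite label_inH. Qed.

Let eX : exq X.
Proof. by rewrite /exq loop_edge_inH. Qed.

Let premise u : u != X -> is_premise (step_trace r u).
Proof.
by case: u / occ_plugP => w; rewrite ?tC //; case: w => [[]|w]; rewrite ?tH ?eqxx.
Qed.

Let x_notin_B : x \notin bvars B.
Proof.
apply/negP=> /bvars_label[v vx]; have [[u uv]|] := step_trace_surj r v; last by rewrite vx.
have /(step_binder rA x uv) ux := vx; move: uv.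
by rewrite (uniq_bvars_label (proj1 (andP rA)) ux lX) tX.
Qed.

Let edge_parent u v u' v' : step_trace r u = Premise u' -> step_trace r v = Premise v' ->
  loop_edge u v = loop_edge u' v'.
Proof.
move: u' v'; case: u / occ_plugP => u; case: v / occ_plugP => v u' v'; rewrite ?tC.
- by move=> [<-] [<-]; apply: loop_edge_inC.
- case: v => [[]|v]; first by rewrite -/X tX.
  by rewrite tH => -[<-] [<-]; apply: loop_edge_inCH.
- case: u => [[]|u]; first by rewrite -/X tX.
  by rewrite tH => -[<-] [<-]; rewrite loop_edge_sym [RHS]loop_edge_sym; apply: loop_edge_inCH.
case: u => [[]|u]; first by rewrite -/X tX.
case: v => [[]|v]; first by rewrite -/X tX.
by rewrite !tH => -[<-] [<-]; rewrite !loop_edge_inH /= loop_edge_fsubst_trace.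
Qed.

(* If x does not occur in the scope then t is arbitrary, and the new variable is
   better left unsubstituted. *)
Let good_vacuous : x \notin fvars A0 -> good Phi -> good (DStep Phi r).
Proof.
move=> xA0 [d [dd acy]]; exists d; split.
  apply: (dualizes_ext (s := Var) (dualizes_step r rA dd)).
    by move=> z nz; apply: (proj1 dd); apply: contra nz; apply: (step_exvar r rA).
  move=> u a ua; rewrite asubst_id -[RHS]asubst_comp asubst_single_notin //.
  apply: (rectified_binder_atom rA _ _ ua); first by rewrite mem_head.
  case=> // w b wb; apply/negP=> /(@atom_var _ A0 w _ _ wb); rewrite (negPf xA0) /=.
  by have /andP[/uniq_bvars_plug/= /andP[/negPf->]] := rA.
apply: acyclic_premise acy => // u v luv.
apply: premise; apply: contraTneq luv => ->; rewrite /leaps /same_ai cX andbF /=.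
rewrite /depends eX lX andbF orbF; case vy: (lbl v) => [y|?]; rewrite ?andbF //.
rewrite (proj1 dd); last by apply: contra x_notin_B; apply: exvar_bvars.
apply/negP=> /and3P[_ nv]; rewrite inE => /eqP yx.
by move: nv; rewrite (uniq_bvars_label (proj1 (andP rA)) vy (v := X)) ?eX // yx lX.
Qed.

Section Proper.
Hypothesis xA0 : x \in fvars A0.
Variable d : subst Sg.
Hypothesis dd : dualizes Phi d.
Let d' : subst Sg := fun z => tsubst d (single x t z).
Variable v0 : occ B.

(** The binders above the hole through which the dependency of [X] on [w] is inherited: those of the
    variables z of [t]. *)
Let source c w := spine c && depends d (inC (fsubst (single x t) A0) c) (parent r v0 w).
Let sourced u w := (u == X) ==> [exists c, source c w].

(** The label y of [w] occurs in [d v] for some variable [v] of [t]. As [v] is free in the instance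
    of [A0] and the premise is rectified, [v] can be bound only by a quantifier above the hole. If
    [v] is existential, its binder is a source; otherwise [d] fixes [v], so that y is [v] and [w] is
    itself a universal binder above the hole. *)
Lemma leap_new w : leaps (DStep Phi r) d' X w ->
  [exists c, source c w] \/ exists c : cocc K, [/\ spine c, ~~ exq w & w = inC _ c].
Proof.
move=> lXw; have wX : w != X by apply: contraTneq lXw => ->; rewrite leaps_irr.
have tw := parentE v0 (premise wX); move: lXw.
rewrite /leaps /same_ai cX andbF /= /depends eX lX andbF orbF.
case wy: (lbl w) => [y|?]; rewrite ?andbF // => /and3P[_ nw].
rewrite {1}/d' {1}/single /= eqxx => /tvars_tsubst[v vt yv].
have vA : v \in fvars (fsubst (single x t) A0).
  by apply: fvars_fsubst xA0 _ _; rewrite /single /= eqxx.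
have bound y' : y' \in bvars B -> y' \in fvars (fsubst (single x t) A0) ->
    exists2 c : cocc K, spine c & lbl (inC (fsubst (single x t) A0) c) = inl y'.
  move=> y'B y'A; apply: spine_var y'A _.
  by have /andP[_ /hasPn] := rB; apply.
have lw : lbl (parent r v0 w) = inl y by apply/(step_binder rA y tw).
case ev: (exvar B v); [left | right].
  have [c cs cv] := bound v (exvar_bvars ev) vA.
  apply/existsP; exists c; rewrite /source cs /= /depends cv lw yv (step_exq tw) nw !andbT.
  by have/exvarP[z ez zv] := ev; rewrite (uniq_bvars_label (proj1 (andP rB)) cv zv).
move: yv; rewrite (proj1 dd) ?ev // inE => /eqP yv; rewrite -yv in vA.
have [c cs cy] := bound y (label_bvars lw) vA.
exists c; split=> //; apply: (uniq_bvars_label (proj1 (andP rA)) wy).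
by rewrite -cy; apply: label_inC.
Qed.

(** The second case of [leap_new] cannot occur in a chordless cycle: the fograph partner of a
    universal binder above the hole lies outside what it quantifies, hence is adjacent to [X]
    whenever the binder is its neighbour, and this is a chord. *)
Lemma alternating_sourced c p q : alternating loop_edge (leaps (DStep Phi r) d') c ->
  p \in c -> q \in c -> leaps (DStep Phi r) d' p.2 q.1 -> sourced p.2 q.1 && sourced q.1 p.2.
Proof.
move=> altc pc qc lpq.
have chord w w' : leaps (DStep Phi r) d' X w -> loop_edge w w' -> w' != X /\ loop_edge w' X \/ [exists c, source c w].
  move=> lXw eww'; have [|[k [ks nw wE]]] := leap_new lXw; [by right | left].
  move: eww' nw; rewrite wE; case: w' / occ_plugP => [k'|w'] ekk' nk; last first.
    by rewrite spine_hole // (negPf nk) in ekk'.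
  split; first by apply/eqP=> /inC_inH.
  exact: spine_all_adj ks nk ekk'.
apply/andP; split; apply/implyP=> /eqP XE.
  rewrite XE in lpq; have [[qX eqX]|//] := chord _ q.2 lpq (alternating_edge altc qc).
  have pq : p != q by apply: contraNneq qX => <-; rewrite XE.
  have := alternating_apart (@loop_edge_sym _ _) altc pc qc pq.
  by rewrite /apart XE [loop_edge X q.2]loop_edge_sym eqX !orbT.
rewrite XE leaps_sym in lpq; have := alternating_edge altc pc; rewrite loop_edge_sym => e21.
have [[pX epX]|//] := chord _ p.1 lpq e21.
have pq : p != q by apply: contraNneq pX => ->; rewrite XE.
have := alternating_apart (@loop_edge_sym _ _) altc pc qc pq.
by rewrite /apart XE epX.
Qed.

(** A vertex together with its leap partner; the partner decides which source stands in for [X]. *)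
Let token := (occ A * occ A)%type.

Let image (a : token) : occ B :=
  if a.1 == X then
    if [pick c | source c a.2] is Some c then inC _ c else v0
  else parent r v0 a.1.

(** The source binds further out than [X] and may be adjacent to more; these are its edges in
    excess. *)
Let extra w (u : occ A) :=
  [&& sourced X w, u != X, ~~ loop_edge X u & loop_edge (image (X, w)) (parent r v0 u)].

(** An interpolation between conclusion and premise: [s] lists the partners whose copy of [X] has
    not yet received its excess edges. If [s] is everything, these are the edges of the conclusion;
    if [s] is empty, they are those of the premise, pulled back along [image]. *)
Let edges (s : seq (occ A)) : rel token := fun a b =>
  [|| loop_edge a.1 b.1,
      [&& a.1 == X, a.2 \notin s & extra a.2 b.1] |
      [&& b.1 == X, b.2 \notin s & extra b.2 a.1]].

Let tleaps : rel token :=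
  decorated (fun u v => leaps (DStep Phi r) d' u v && (sourced u v && sourced v u)).

Let imageX w : sourced X w -> exists2 c, source c w & image (X, w) = inC _ c.
Proof.
rewrite /sourced /image /= eqxx /= => /existsP[c cw].
by case: pickP => [c' c'w|/(_ c)]; [exists c' | rewrite cw].
Qed.

Let source_ex c w : source c w -> spine c /\ exq (inC (fsubst (single x t) A0) c).
Proof. by case/andP=> -> /and3P[->]. Qed.

Let parent_inC c : parent r v0 (inC _ c) = inC _ c.
Proof. by rewrite /parent tC. Qed.

Let parent_inH w : parent r v0 (inH K (inr w : occ (Ex x A0))) = inH K (fsubst_trace (single x t) w).
Proof. by rewrite /parent tH. Qed.

Let edge_image w u : sourced X w -> u != X -> loop_edge X u -> loop_edge (image (X, w)) (parent r v0 u).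
Proof.
move=> /imageX[c /source_ex[cs ec] ->]; case: u / occ_plugP => [k|[[]|u]]; rewrite ?eqxx //.
  move=> _; rewrite parent_inC loop_edge_sym => eXk; have [w0 _] := exists_literal (fsubst (single x t) A0).
  by apply: (spine_ex_adj (w := w0)) => //; rewrite -(loop_edge_inCH k (inl tt : occ (Ex x A0))).
by rewrite parent_inH spine_hole.
Qed.

(** By [spine_ex_path], a neighbour [z] of [u] that is not adjacent to [X] is adjacent to the source
    as well, so it would be [extra] too. This is the condition on [U] in [acyclic_join]. *)
Let extra_path w u z : extra w u -> ~~ extra w z -> loop_edge u z -> loop_edge X z.
Proof.
case/and4P=> sw uX nXu ewu; rewrite /extra sw /= => nz euz.
case: (eqVneq z X) euz nz => [-> //|zX euz /=]; case: (boolP (loop_edge X z)) => //= nXz.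
case: (imageX sw) ewu => c /source_ex[cs ec] -> ewu; apply: contraNT => _; move: euz ewu.
rewrite (edge_parent (parentE v0 (premise uX)) (parentE v0 (premise zX))).
move: uX zX nXu nXz.
case: u / occ_plugP => [k|[[]|u]]; rewrite ?eqxx ?loop_edge_inH //.
case: z / occ_plugP => [k'|[[]|z]]; rewrite ?eqxx ?loop_edge_inH //.
rewrite !parent_inC ![loop_edge X _]loop_edge_sym => _ _ nk nk'.
have [w0 _] := exists_literal (fsubst (single x t) A0).
rewrite (loop_edge_inCH k _ w0) in nk; rewrite (loop_edge_inCH k' _ w0) in nk'.
by move=> ekk' eck; apply: (spine_ex_path cs ec nk nk').
Qed.

Lemma edges_sym s : symmetric (edges s).
Proof. by move=> a b; rewrite /edges loop_edge_sym; congr (_ || _); exact: orbC. Qed.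

Lemma tleaps_sym : symmetric tleaps.
Proof.
move=> a b; rewrite /tleaps /decorated leaps_sym [sourced a.1 _ && _]andbC.
by congr (_ && _); exact: andbC.
Qed.

(** Here [S] holds at most the token of [X] with partner [w], which makes its module condition
    trivial; this is the gain from treating the partners one at a time. *)
Lemma edges_drop w s : acyclic (edges s) tleaps -> acyclic (edges (w :: s)) tleaps.
Proof.
pose S (a : token) := [&& a.1 == X, a.2 == w & w \notin s].
pose U (a : token) := extra w a.1.
apply: (@acyclic_join _ _ _ _ S U); [exact: edges_sym | exact: tleaps_sym | | | |].
- move=> [a1 a2] [b1 b2]; rewrite /edges /S /U /= !inE !negb_or.
  move: (loop_edge a1 b1) (a1 == X) (b1 == X) => e aX bX.
  case: (eqVneq a2 w) => [->|_]; case: (eqVneq b2 w) => [->|_] /=;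
    move: (w \in s) (a2 \in s) (b2 \in s) (extra w b1) (extra w a1) (extra a2 b1) (extra b2 a1);
    by case: e aX bX => [] [] [] // [] // [] // [] // [] // [] // [] // [].
- move=> [a1 a2] [u1 u2] /and3P[/= /eqP-> /eqP-> _]; rewrite /U /= => /and4P[sw uX nXu euw].
  apply/andP; split; first by apply: contraNneq uX => -[<-].
  by rewrite /edges /= (negPf nXu) (negPf uX) mem_head /= andbF.
- by move=> [a1 a2] [b1 b2] z /and3P[/= /eqP-> /eqP-> _] /and3P[/= /eqP-> /eqP-> _].
move=> [a1 a2] [u1 u2] [z1 z2] /and3P[/= /eqP-> /eqP-> _]; rewrite /U /= => uw nzw.
have /and4P[sw uX nXu euw] := uw.
rewrite /edges /=; case: (eqVneq z1 X) => [->|zX]; first by move: eX; rewrite /exq => ->.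
by rewrite (negPf uX) /= !orbF => euz; rewrite (extra_path uw nzw euz).
Qed.

Lemma acyclic_ex : acyclic loop_edge (leaps Phi d) -> acyclic loop_edge (leaps (DStep Phi r) d').
Proof.
move=> acy; apply: (@acyclic_restrict _ _ _ (fun u v => sourced u v && sourced v u)).
  exact: alternating_sourced.
apply: acyclic_decorated; rewrite -/tleaps.
suff : acyclic (edges (enum (occ A))) tleaps.
  move=> acyE; apply: (acyclic_map (f := id) (P := predT)) acyE => // a b _ _.
  by rewrite /edges !mem_enum !inE !andbF !orbF.
elim: (enum _) => [|w s IH]; last exact: edges_drop.
apply: (acyclic_map (f := image) (P := fun a => sourced a.1 a.2)) acy.
  move=> [a1 a2] [b1 b2]; rewrite /tleaps /decorated /= => /and3P[/andP[lab /andP[sab sba]] /eqP-> /eqP->].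
  rewrite sab sba /=.
  have lab' u w : sourced u w -> leaps (DStep Phi r) d' u w -> u = X -> leaps Phi d (image (u, w)) (image (w, u)).
    move=> suw luw uX; rewrite uX in suw luw *; have [c /andP[_ cw] ->] := imageX suw.
    have wX : w != X by apply: contraTneq luw => ->; rewrite leaps_irr.
    by rewrite {1}/image /= (negPf wX) /leaps cw orbT.
  case: (eqVneq a1 X) => [aX|aX]; first exact: lab'.
  case: (eqVneq b1 X) => [bX|bX]; first by rewrite leaps_sym; apply: lab' => //; rewrite leaps_sym.
  rewrite /image /= (negPf aX) (negPf bX).
  apply: leaps_premise lab => //; try exact/parentE/premise.
  move=> z y ez _; rewrite /d' /single /=; case: eqVneq => [zx|//].
  by move: x_notin_B; rewrite -zx (exvar_bvars ez).
move=> [a1 a2] [b1 b2] /= sa sb; rewrite /edges /=.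
case: (eqVneq a1 X) sa => [->|aX] sa; case: (eqVneq b1 X) sb => [->|bX] sb.
(* Two copies of [X] are adjacent through the loop at [X]. Their images are existential binders
   above the hole, adjacent to each other or, if equal, to themselves, again by the loop. *)
- move: (eX); rewrite /exq => -> /=; have [c /source_ex[cs ec] ->] := imageX sa.
  have [c' /source_ex[cs' ec'] ->] := imageX sb; have [w0 _] := exists_literal (fsubst (single x t) A0).
  by symmetry; apply: (spine_ex_adj (w := w0)) => //; rewrite spine_hole.
- rewrite orbF /extra sa bX /= [image (b1, _)]/image /= (negPf bX).
  by case: (boolP (loop_edge X b1)) => //= /(edge_image sa bX)->.
- rewrite /= /extra sb aX /= [image (a1, _)]/image /= (negPf aX) loop_edge_sym [RHS]loop_edge_sym.
  by case: (boolP (loop_edge X a1)) => //= /(edge_image sb aX)->.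
rewrite !orbF /image /= (negPf aX) (negPf bX).
by apply: edge_parent; apply/parentE/premise.
Qed.

End Proper.

Lemma good_ex : good Phi -> good (DStep Phi r).
Proof.
case: (boolP (x \in fvars A0)) => [xA0|]; last exact: good_vacuous.
case=> d [dd acy]; exists (fun z => tsubst d (single x t z)).
split; first exact: (dualizes_step r rA dd).
by have [v0 _] := exists_literal B; apply: (acyclic_ex xA0 dd v0).
Qed.

End Exists.

Lemma derivation_good A (Phi : derivation ftrue A) : rectified_derivation Phi -> good Phi.
Proof.
elim: Phi => [|C {}A Phi IH r].
  by exists Var; split; [split | case=> // -[[] []] c].
case/andP=> rA rPhi; have gPhi := IH rPhi; have rC := rectified_derivationP rPhi.
case: r Phi rA rC {IH rPhi} gPhi => {C A} K C A [x|a|D|D E F|D E|x t D ft|D E e] Phi rA rC gPhi.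
- exact (good_all rA gPhi).
- exact (good_ai rA gPhi).
- exact (good_t rA gPhi).
- exact (good_s rA gPhi).
- exact (good_mix rA gPhi).
- exact (good_ex ft rA rC gPhi).
- exact (good_eqv e rA gPhi).
Qed.

End LinkAndWitness.

(** * Modules and scopes *)

Section Modules.
Variable Sg : signature.
Implicit Types (G H : lgraph Sg).

Definition autonomous G (M : {set vertex G}) :=
  forall v w z, v \in M -> w \in M -> z \notin M -> edge G v z = edge G w z.

Lemma is_moduleP G (M : {set vertex G}) : reflect (autonomous M) (is_module M).
Proof.
apply: (iffP forall_inP) => [mM v w z vM wM zM | mM v vM].
  have /forall_inP/(_ w wM)/eqP/setP/(_ z) := mM v vM.
  by rewrite !inE zM.
apply/forall_inP=> w wM; apply/eqP/setP=> z; rewrite !inE.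
by case: (boolP (z \in M)) => //= zM; apply: mM.
Qed.

Lemma strong_autonomous G (M M' : {set vertex G}) b w :
  is_strong M -> autonomous M' -> b \in M -> b \notin M' -> w \in M -> w \in M' -> M' \subset M.
Proof.
case/andP=> _ /forallP/(_ M')/implyP + /is_moduleP mM' bM bM' wM wM' => /(_ mM')/or3P[|//|].
- by move/subsetP/(_ b bM); rewrite (negPf bM').
- by move=> dis; rewrite (disjointFr dis wM) in wM'.
Qed.

Section Membership.
Variables (j : bool) (G H : lgraph Sg).
Implicit Types (M : {set vertex G}) (N : {set vertex H}).
Notation GH := (vertex (gcombine j G H)).

Lemma mem_inl M u : ((inl u : GH) \in (inl @: M : {set GH})) = (u \in M).
Proof. by rewrite mem_imset //; apply: inl_inj. Qed.

Lemma mem_inr N u : ((inr u : GH) \in (inr @: N : {set GH})) = (u \in N).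
Proof. by rewrite mem_imset //; apply: inr_inj. Qed.

Lemma inr_inl M u : ((inr u : GH) \in (inl @: M : {set GH})) = false.
Proof. by apply/imsetP=> -[]. Qed.

Lemma inl_inr N u : ((inl u : GH) \in (inr @: N : {set GH})) = false.
Proof. by apply/imsetP=> -[]. Qed.

End Membership.

Definition memE := (mem_inl, mem_inr, inr_inl, inl_inr).

Lemma autonomous_inl j G H (M : {set vertex G}) :
  autonomous M -> @autonomous (gcombine j G H) (inl @: M).
Proof. by move=> mM [v|v] [w|w] [z|z] /=; rewrite ?memE //; apply: mM. Qed.

Lemma autonomous_inr j G H (M : {set vertex H}) :
  autonomous M -> @autonomous (gcombine j G H) (inr @: M).
Proof. by move=> mM [v|v] [w|w] [z|z] /=; rewrite ?memE //; apply: mM. Qed.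

(* The vertices of the formula under the quantifier of the binder [b], which is
   joined to all of them ([q]) or to none. *)
Definition body G b (q : bool) (M : {set vertex G}) :=
  [/\ autonomous M, autonomous (b |: M), b \notin M,
      exists2 v, v \in M & is_literal v & forall v, v \in M -> edge G b v = q].

Lemma body_inl j G H b q (M : {set vertex G}) :
  body b q M -> @body (gcombine j G H) (inl b) q (inl @: M).
Proof.
case=> mM mbM bM [v vM lv] adj; split; rewrite -?imsetU1 ?memE //; try exact: autonomous_inl.
- by exists (inl v); rewrite ?memE.
- by case=> w; rewrite memE //; apply: adj.
Qed.

Lemma body_inr j G H b q (M : {set vertex H}) :
  body b q M -> @body (gcombine j G H) (inr b) q (inr @: M).
Proof.
case=> mM mbM bM [v vM lv] adj; split; rewrite -?imsetU1 ?memE //; try exact: autonomous_inr.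
- by exists (inr v); rewrite ?memE.
- by case=> w; rewrite memE //; apply: adj.
Qed.

Lemma body_quantifier j x (A : formula Sg) :
  @body (gcombine j (gvertex (inl x)) (graph A)) (inl tt) j (inr @: [set: occ A]).
Proof.
split; rewrite ?memE //.
- by apply: autonomous_inr => v w z _ _; rewrite inE.
- by move=> v w [[]|z] _ _; rewrite in_setU ?in_set1 ?memE ?inE ?eqxx ?orbT.
- by have [v [a va]] := exists_literal A; exists (inr v); rewrite ?memE ?inE //; exists a.
- by case=> v //; rewrite memE.
Qed.

Lemma binder_body (A : formula Sg) (b : occ A) x :
  label (graph A) b = inl x -> exists M, @body (graph A) b (exq b) M.
Proof.
elim: A b => [a | A IHA B IHB | A IHA B IHB | y A IH | y A IH] //=.
1,2: case=> b bx; [have [M Mb] := IHA b bx | have [M Mb] := IHB b bx];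
  [exists (inl @: M); exact: body_inl Mb | exists (inr @: M); exact: body_inr Mb].
all: case=> [[] _ | b bx]; first by eexists; exact: body_quantifier.
all: by have [M Mb] := IH b bx; exists (inr @: M); exact: body_inr Mb.
Qed.

(** [M'] contains some [w] other than [b]. If [w] lies in [M], then [M] is a module that meets [M']
    and misses [b]; if not, [b |: M] is a module that meets [M'] in [b] and misses [w]. In both
    cases strength of [M'] gives the inclusion. *)
Lemma body_sub_strong G b q (M M' : {set vertex G}) :
  body b q M -> proper_strong_module M' -> b \in M' -> M \subset M'.
Proof.
case=> mM mbM bM _ _ /andP[sM' cM'] bM'.
have [w wM' wb] : exists2 w, w \in M' & w != b.
  apply/exists_inP; move: cM'; rewrite (cardsD1 b) bM' ltnS card_gt0.
  by case/set0Pn=> w; rewrite !inE => /andP[wb wM']; apply/exists_inP; exists w.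
case: (boolP (w \in M)) => [wM|wM]; first exact: strong_autonomous sM' mM bM' bM wM' wM.
have : b |: M \subset M'.
  by apply: (strong_autonomous sM' mbM wM' _ bM'); rewrite !inE ?eqxx // negb_or wb.
by apply: subset_trans; apply: subsetUr.
Qed.

(* The largest conjunction in which [b] is a conjunct; the last clause makes it
   strong. *)
Definition conjunction G b (M : {set vertex G}) :=
  [/\ autonomous M, b \in M, exists2 w, w \in M & w != b,
      forall v, v \in M -> v != b -> edge G b v &
      forall z, z \notin M -> edge G z b ->
        exists w, [/\ w \notin M, ~~ edge G w b & edge G z w]].

Lemma conjunction_setT G b w : w != b -> (forall v, v != b -> edge G b v) ->
  conjunction b [set: vertex G].
Proof.
move=> wb adj; split=> //; first by move=> v u z _ _; rewrite inE.
- by exists w.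
- by move=> v _; apply: adj.
- by move=> z; rewrite inE.
Qed.

Lemma conjunction_outside G b (M : {set vertex G}) :
  conjunction b M -> M != setT -> exists2 w, w \notin M & ~~ edge G w b.
Proof.
case=> _ _ _ _ out; rewrite -subTset => /subsetPn[z _ zM].
case: (boolP (edge G z b)) => [/(out z zM)[w [wM wb _]] | zb]; first by exists w.
by exists z.
Qed.

(** The conjunction grows only when a join is applied to a graph that it fills, and then it becomes
    everything. If it does not fill the graph, a vertex outside it and not adjacent to [b] is the
    witness for the new neighbours of [b]. *)
Lemma conjunction_inl j G H b (M : {set vertex G}) :
  conjunction b M -> exists M', @conjunction (gcombine j G H) (inl b) M'.
Proof.
move=> cM; have [mM bM [w wM wb] adj out] := cM.
have [/andP[jT /eqP MT]|jMT] := boolP (j && (M == setT)).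
  exists setT; apply: (@conjunction_setT (gcombine j G H) (inl b) (inl w)) => // -[v|v] vb //=.
  by apply: adj => //; rewrite MT inE.
exists (inl @: M); split; rewrite ?memE //.
- exact: autonomous_inl.
- by exists (inl w); rewrite ?memE.
- by case=> v; rewrite memE //; apply: adj.
case=> z; rewrite memE /=.
  by move=> zM /(out z zM)[w' [? ? ?]]; exists (inl w'); rewrite memE.
move=> _ jT; have [|w' w'M w'b] := conjunction_outside cM; first by rewrite jT in jMT.
by exists (inl w'); rewrite memE.
Qed.

Lemma conjunction_inr j G H b (M : {set vertex H}) :
  conjunction b M -> exists M', @conjunction (gcombine j G H) (inr b) M'.
Proof.
move=> cM; have [mM bM [w wM wb] adj out] := cM.
have [/andP[jT /eqP MT]|jMT] := boolP (j && (M == setT)).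
  exists setT; apply: (@conjunction_setT (gcombine j G H) (inr b) (inr w)) => // -[v|v] vb //=.
  by apply: adj => //; rewrite MT inE.
exists (inr @: M); split; rewrite ?memE //.
- exact: autonomous_inr.
- by exists (inr w); rewrite ?memE.
- by case=> v; rewrite memE //; apply: adj.
case=> z; rewrite memE /=; last first.
  by move=> zM /(out z zM)[w' [? ? ?]]; exists (inr w'); rewrite memE.
move=> _ jT; have [|w' w'M w'b] := conjunction_outside cM; first by rewrite jT in jMT.
by exists (inr w'); rewrite memE.
Qed.

Lemma exq_conjunction (A : formula Sg) (b : occ A) :
  exq b -> exists M, @conjunction (graph A) b M.
Proof.
elim: A b => [a | A IHA B IHB | A IHA B IHB | y A IH | y A IH] //.
1,2: case=> b eb; [have [M] := IHA b eb | have [M] := IHB b eb];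
  [exact (@conjunction_inl _ _ _ b M) | exact (@conjunction_inr _ _ _ b M)].
all: case=> [[] // | b eb]; last by have [M] := IH b eb; exact (@conjunction_inr _ _ _ b M).
move=> _; have [v _] := exists_literal A; exists setT.
by apply: (@conjunction_setT (graph (Ex y A)) (inl tt) (inr v)) => // -[[]|u].
Qed.

(** If a module [M'] overlapped [M], every vertex of [M'] outside [M] would be adjacent to [b]
    ([joined]). The last clause of [conjunction] then gives a [w] outside both that is adjacent to
    such a vertex but not to [b], although the two modules share a vertex [u] and so force [w] to be
    adjacent to [b]. For minimality, a proper strong module containing [b] and [w] absorbs [M] if
    [w] is outside [M], and otherwise absorbs [M :\ b], which is a module because [b] is adjacent to
    all of it. *)
Lemma conjunction_scope G b (M : {set vertex G}) :
  symmetric (edge G) -> conjunction b M -> is_scope b M.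
Proof.
move=> se [mM bM [w0 w0M w0b] adj out]; split=> //.
  apply/andP; split; last first.
    by rewrite (cardsD1 b) bM ltnS card_gt0; apply/set0Pn; exists w0; rewrite !inE w0b.
  apply/andP; split; first exact/is_moduleP.
  apply/forallP=> M'; apply/implyP=> /is_moduleP mM'; apply/negPn/negP.
  rewrite !negb_or => /and3P[/subsetPn[u' u'M u'M'] /subsetPn[z zM' zM]].
  rewrite -setI_eq0 => /set0Pn[u]; rewrite inE => /andP[uM uM'].
  have joined y : y \in M' -> y \notin M -> edge G y b.
    move=> yM' yM.
    case: (boolP (b \in M')) => bM'; last first.
      by rewrite -(mM' u y b) // se; apply: adj => //; apply: contraNneq bM' => <-.
    have u'b : u' != b by apply: contraNneq u'M' => ->.
    have yu' : edge G y u' by rewrite -(mM' b y u') //; apply: adj.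
    by rewrite se -(mM u' b y) // se.
  have [w [wM wb zw]] := out z zM (joined z zM' zM).
  case: (boolP (w \in M')) => [wM'|wM']; first by rewrite joined in wb.
  move: wb; rewrite (_ : edge G w b = true) //.
  have <- : edge G u w = edge G w b by rewrite [RHS]se; apply: mM.
  by rewrite (mM' u z w).
move=> M' psM' bM'; have /andP[sM' cM'] := psM'.
have [w wM' wb] : exists2 w, w \in M' & w != b.
  apply/exists_inP; move: cM'; rewrite (cardsD1 b) bM' ltnS card_gt0.
  by case/set0Pn=> w; rewrite !inE => /andP[wb wM']; apply/exists_inP; exists w.
case: (boolP (w \in M)) => [wM|wM]; last exact: (strong_autonomous sM' mM wM' wM bM' bM).
have mMb : autonomous (M :\ b).
  move=> v v' z; rewrite !inE => /andP[vb vM] /andP[v'b v'M].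
  rewrite negb_and negbK => /predU1P[->|zM]; last exact: mM.
  by rewrite ![edge G _ b]se !adj.
have : M :\ b \subset M'.
  by apply: (strong_autonomous sM' mMb bM' _ wM'); rewrite !inE ?eqxx ?wb.
by rewrite subDset => sub; apply: subset_trans sub _; rewrite subUset sub1set bM' /=.
Qed.
End Modules.

(** * The fonet *)

Section Fograph.
Variable Sg : signature.
Implicit Types (A : formula Sg).

Notation lbl := (label (graph _)).

Lemma edge_sym A : symmetric (edge (graph A)).
Proof. by move=> u v; rewrite !edgeE eq_sym loop_edge_sym. Qed.

Lemma graph_P4_free A (u v w z : occ A) :
  edge (graph A) u v -> edge (graph A) v w -> edge (graph A) w z ->
  [|| edge (graph A) u w, edge (graph A) u z | edge (graph A) v z].
Proof.
elim: A u v w z => [a | A IHA B IHB | A IHA B IHB | y A IH | y A IH] //=.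
1,2: by case=> u; case=> v; case=> w; case=> z //=; rewrite ?orbT //; first [exact: IHA | exact: IHB].
all: by case=> u; case=> v; case=> w; case=> z //=; rewrite ?orbT //; exact: IH.
Qed.

Lemma graph_cograph A : cograph (graph A).
Proof.
split; first exact: edge_sym.
  by move=> u; rewrite edgeE eqxx.
case=> u [v [w [z [_ /and3P[uv vw wz] /negP]]]]; apply.
exact: graph_P4_free uv vw wz.
Qed.

(** A proper strong module containing [b] of least cardinality will do: it is comparable with any
    other one, as both contain [b]. The whole vertex set is a candidate, being proper because a
    binder has a nonempty body. *)
Lemma scope_exists A (b : occ A) x : lbl b = inl x -> exists M, @is_scope _ (graph A) b M.
Proof.
case/binder_body=> H [_ _ bH [h hH _] _].
pose P (M : {set vertex (graph A)}) := proper_strong_module M && (b \in M).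
have PT : P setT.
  rewrite /P inE andbT; apply/andP; split.
    apply/andP; split; first by apply/is_moduleP => v w z _ _; rewrite inE.
    by apply/forallP=> M; apply/implyP=> _; rewrite subsetT orbT.
  rewrite (cardsD1 b) inE ltnS card_gt0; apply/set0Pn; exists h.
  by rewrite !inE andbT; apply: contraNneq bH => <-.
case: (arg_minnP (fun M : {set vertex (graph A)} => #|M|) PT) => M /andP[psM bM] minM.
exists M; split=> // M' psM' bM'; have /andP[/andP[mM' _] _] := psM'.
have /andP[/andP[_ /forallP/(_ M')/implyP/(_ mM')/or3P[//|M'M|dis]] _] := psM.
  have MM' : #|M| <= #|M'| by apply: minM; rewrite /P psM' bM'.
  by move: (M'M); rewrite subEproper => /predU1P[->//|/proper_card]; rewrite ltnNge MM'.
by rewrite (disjointFr dis bM) in bM'.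
Qed.

Lemma graph_fograph A : rectified A -> fograph (graph A).
Proof.
case/andP=> uA _; split; first exact: graph_cograph.
  by have [v [a va]] := exists_literal A; exists v, a.
move=> x b bx; have [M Mb] := scope_exists bx; exists M; split=> //.
  have [H Hb] := binder_body bx; have [psM bM _] := Mb.
  have [_ _ _ [v vH lv] _] := Hb; exists v => //.
  exact: (subsetP (body_sub_strong Hb psM bM)).
by move=> b' _ b'x; apply: uniq_bvars_label b'x bx.
Qed.

Lemma exq_existential A (b : occ A) x :
  exq b -> lbl b = inl x -> @existential_binder _ (graph A) x b.
Proof.
move=> eb bx; split=> //; have [M cM] := exq_conjunction eb.
by exists M; [exact: conjunction_scope (@edge_sym A) cM | case: cM].
Qed.

(** The scope contains the body of [b], whose adjacency to [b] reveals the quantifier. *)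
Lemma scope_exq A (b : occ A) x M q : lbl b = inl x -> @is_scope _ (graph A) b M ->
  (forall v, v \in M -> v != b -> edge (graph A) b v = q) -> exq b = q.
Proof.
move=> bx [psM bM _] adj; have [H Hb] := binder_body bx.
have /subsetP HM := body_sub_strong Hb psM bM; have [_ _ bH [v vH _] bv] := Hb.
by rewrite -(bv v vH) adj ?HM //; apply: contraNneq bH => <-.
Qed.

Lemma existential_exq A (b : occ A) x : @existential_binder _ (graph A) x b -> exq b.
Proof. by case=> bx [M Mb adj]; exact: (scope_exq (q := true) bx Mb adj). Qed.

Lemma universal_exq A (b : occ A) x : @universal_binder _ (graph A) x b -> ~~ exq b.
Proof.
case=> bx [M Mb adj]; apply/negbT/(scope_exq bx Mb) => v vM vb.
exact/negbTE/adj.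
Qed.

End Fograph.

(** * From a bimatching to an alternating cycle *)

Section Matching.
Variable T : finType.
Implicit Types (e l : rel T) (W : {set T}).

Lemma dihedral (W : {set T}) (m n : T -> T) :
  {in W, forall u, m u \in W} -> {in W, forall u, n u \in W} ->
  {in W, involutive m} -> {in W, involutive n} ->
  {in W, forall u, m u != u} -> {in W, forall u, n u != u} ->
  forall k u, u \in W -> iter k (n \o m) u != m u.
Proof.
move=> mW nW mK nK m_ne n_ne k; elim/ltn_ind: k => -[|[|k]] IH u uW.
- by rewrite eq_sym m_ne.
- by rewrite /= n_ne ?mW.
have nmW v : v \in W -> n (m v) \in W by move=> /mW/nW.
have itW j v : v \in W -> iter j (n \o m) v \in W.
  by move=> vW; elim: j => //= j /nmW.
apply: contraNneq (IH k (leqnSn _) _ (nmW _ uW)) => it.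
have {}it : n (m (iter k (n \o m) (n (m u)))) = m u by move: it; rewrite iterS iterSr.
by rewrite -[iter _ _ _]mK ?itW ?nmW // -[m (iter _ _ _)]nK ?mW ?itW ?nmW // it.
Qed.

(* Following the two matchings in turn traces an alternating cycle. *)
Lemma matching_alternating e l W (m n : T -> T) w :
  symmetric e ->
  w \in W ->
  (forall u, u \in W -> [/\ m u \in W, e u (m u), m u != u & forall v, v \in W -> v != u -> e u v -> v = m u]) ->
  (forall u, u \in W -> [/\ n u \in W, l u (n u), n u != u & n (n u) = u]) ->
  exists2 c, alternating e l c & c != [::].
Proof.
move=> se wW mP nP.
have mW u : u \in W -> m u \in W by case/mP.
have nW u : u \in W -> n u \in W by case/nP.
have mK : {in W, involutive m}.
  move=> u uW; have [muW eu mu uniqu] := mP u uW; have [_ _ _ uniqmu] := mP _ muW.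
  by apply/esym/uniqmu; rewrite // 1?eq_sym // se.
have nK : {in W, involutive n} by move=> u /nP[].
have m_ne : {in W, forall u, m u != u} by move=> u /mP[].
have n_ne : {in W, forall u, n u != u} by move=> u /nP[].
have noloop := dihedral mW nW mK nK m_ne n_ne.
pose h := n \o m; have hW : {homo h : u / u \in W} by move=> u /mW/nW.
have hinj : {in W &, injective h}.
  by move=> u v uW vW /= /(congr1 n); rewrite !nK ?mW // => /(congr1 m); rewrite !mK.
have itW k u : u \in W -> iter k h u \in W by move=> uW; elim: k => //= k /hW.
have orbW u : u \in orbit h w -> u \in W.
  by case/trajectP=> i _ ->; apply: itW.
have orb_ne u v : u \in orbit h w -> v \in orbit h w -> v != m u.
  move=> /trajectP[i _ ->] /trajectP[j _ ->]; case: (leqP i j) => ij.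
    by rewrite -(subnK ij) iterD; apply: noloop; apply: itW.
  apply: contra_neq (noloop (i - j) (iter j h w) (itW _ _ wW)) => jE.
  by rewrite -iterD subnK ?(ltnW ij) // jE mK ?itW.
exists (map (fun u => (u, m u)) (orbit h w)); last first.
  by rewrite -size_eq0 size_map size_orbit -lt0n order_gt0.
apply/and3P; split.
- by rewrite all_map; apply/allP=> u /orbW/mP[].
- rewrite cycle_map; apply: (sub_in_cycle (P := [in orbit h w]) (e := frel h)); last first.
  + exact: (cycle_orbit_in hW hinj).
  + exact/allP.
  + by move=> u v uo _ /= /eqP <-; have [] := nP _ (mW _ (orbW _ uo)).
rewrite pairwise_map; apply: (sub_in_pairwise (P := [in orbit h w]) (r := fun u v => u != v)).
- move=> u v uo vo uv; have uW := orbW _ uo; have vW := orbW _ vo.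
  have [_ _ _ Pu] := mP u uW; have [muW _ _ Pmu] := mP _ (mW _ uW).
  have mvW := mW _ vW.
  have mumv : m v != m u by apply: contra_neq uv => /(congr1 m); rewrite !mK.
  rewrite /apart /= !negb_or; apply/and4P; split; apply/negP.
  + by move/(Pu v vW); rewrite eq_sym uv => /(_ isT) vm; move: (orb_ne u v uo vo); rewrite vm eqxx.
  + move/(Pu _ mvW); rewrite eq_sym orb_ne // => /(_ isT) e1; by rewrite e1 eqxx in mumv.
  + move/(Pmu v vW); rewrite orb_ne // mK // => /(_ isT) vu; by rewrite vu eqxx in uv.
  + move/(Pmu _ mvW); rewrite mumv mK // => /(_ isT) mvu.
    by have := orb_ne v u vo uo; rewrite mvu eqxx.
- exact/allP.
- by rewrite -uniq_pairwise orbit_uniq.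
Qed.

End Matching.

Section Fonet.
Variables (Sg : signature) (A : formula Sg) (Phi : derivation ftrue A).
Hypotheses (rPhi : rectified_derivation Phi) (nf : no_false A).

Notation lbl := (label (graph _)).

Let rA : rectified A := rectified_derivationP rPhi.

Lemma dualizes_dualizer d : dualizes Phi d -> dualizer (fonet_of Phi) d.
Proof.
case=> fixd dual; split=> [x dx|v w a a' [vw link] va wa]; last exact: dual vw link va wa.
have /exvarP[b eb bx] : exvar A x by apply: contraT => /fixd/dx.
by exists b; apply: exq_existential.
Qed.

(** The variable y is universal, so both the most general dualizer [d0] and its instance [d] fix it.
    Thus the substitution [s] from [d0] to [d] fixes y too and cannot make it disappear from the
    value at x. *)
Lemma dependency_depends d v w :
  dualizes Phi d -> @is_dependency _ (fonet_of Phi) v w -> depends d v w.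
Proof.
move=> dd [x [y [exv uyw [d0 [dual0 mg] yd0]]]].
have ev := existential_exq exv; have nw := universal_exq uyw.
case: exv uyw => [vx _] [wy _]; rewrite /depends ev nw vx wy /=.
have [s ds] := mg d (dualizes_dualizer dd).
have ny : ~~ exvar A y.
  apply/exvarP=> -[b eb bey].
  by move: nw; rewrite (uniq_bvars_label (proj1 (andP rA)) wy bey) eb.
have d0y : d0 y = Var y.
  have fixy : d0 y <> Var y -> False.
    case/(proj1 dual0)=> b eyb; have eb := existential_exq eyb.
    by move/negP: ny; apply; apply/exvarP; exists b => //; case: eyb.
  case E: (d0 y) fixy => [z|f ts] fixy; last by case: fixy.
  by case: (eqVneq z y) => [-> //|zy]; case: fixy => -[zy']; rewrite zy' eqxx in zy.
rewrite ds; apply: mem_tvars_tsubst yd0 _.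
by have := ds y; rewrite d0y /= => <-; rewrite (proj1 dd) // mem_head.
Qed.

Lemma fonet_of_linked d : dualizes Phi d -> linked_fograph (fonet_of Phi).
Proof.
move=> dd; split.
- exact: graph_fograph.
- split=> [u v|v u w] /=; rewrite /same_ai.
    by rewrite (eq_sym (consumer Phi u)); case: eqVneq => [->|_]; rewrite ?andbF.
  by move=> /andP[-> /eqP->] /andP[_ ->].
- move=> v; rewrite /= /same_ai eqxx andbT; case cv: (consumer Phi v) => [n|] // _.
  have [w [vw cw only _]] := consumed_pair rPhi nf cv.
  exists w => //; apply/setP=> u; rewrite !inE /=.
  apply/eqP/orP => [/esym/only[]->|[]/eqP-> //]; by [left | right].
- move=> v w [vw /=]; rewrite /same_ai; case cv: (consumer Phi v) => [n|] //= /eqP/esym cw.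
  have [w' [_ _ only lits]] := consumed_pair rPhi nf cv.
  have [a va aT] := lits v (or_introl erefl); have [a' wa aT'] := lits w (only _ cw).
  exists a, a'; split=> //.
  (* A substitution changes neither the predicate symbol nor its polarity, so duality after [d]
     gives pre-duality of the labels themselves. *)
  have := proj2 dd v w a a' vw; rewrite /same_ai cv cw eqxx => /(_ isT va wa).
  case: a va aT => [||b p ts] // va _; first by case: (nf va).
  case: a' wa aT' => [||b' p' ts'] // wa _.
  by case=> -> pp' _; subst p'; exists b, p, ts, ts'.
- move=> v a va; case: (literal_consumed rPhi va) => [->|cv]; first by left.
  by right; rewrite /= /same_ai cv eqxx.
Qed.

Lemma fonet_of_matching (W : {set vertex (fonet_of Phi)}) : ~ induces_bimatching W.
Proof.
case=> -[W0 mW] [_ nW]; have [d [dd acy]] := derivation_good rPhi.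
have /set0Pn[w wW] : W != set0 by apply/eqP.
have leapsP v u : @leap _ (fonet_of Phi) v u -> leaps Phi d v u.
  by rewrite /leaps; case=> [[-> /= ->] //|/(dependency_depends dd)->|/(dependency_depends dd)->];
    rewrite ?orbT.
have leap_sym v u : @leap _ (fonet_of Phi) v u -> @leap _ (fonet_of Phi) u v.
  case=> [[vu link]||]; [|exact: Or33|exact: Or32].
  by apply: Or31; split; [rewrite eq_sym|move: link; rewrite /= /same_ai => /andP[+ /eqP<-] => ->; rewrite eqxx].
have [m mP] : exists m : occ A -> occ A, forall u, u \in W ->
    [/\ m u \in W, edge (graph A) u (m u) & forall v, v \in W -> edge (graph A) u v -> v = m u].
  apply: (@fin_all_exists _ _ (fun u m => u \in W -> [/\ m \in W, edge (graph A) u m & forall v, v \in W -> edge (graph A) u v -> v = m])).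
  move=> u; case: (boolP (u \in W)) => [/mW[v [[vW uv] only]]|]; last by exists u.
  by exists v => _; split=> // v' v'W uv'; apply/esym/only.
have [n nP] : exists n : occ A -> occ A, forall u, u \in W ->
    [/\ n u \in W, @leap _ (fonet_of Phi) u (n u) & forall v, v \in W -> @leap _ (fonet_of Phi) u v -> v = n u].
  apply: (@fin_all_exists _ _ (fun u n => u \in W -> [/\ n \in W, @leap _ (fonet_of Phi) u n & forall v, v \in W -> @leap _ (fonet_of Phi) u v -> v = n])).
  move=> u; case: (boolP (u \in W)) => [/nW[v [[vW uv] only]]|]; last by exists u.
  by exists v => _; split=> // v' v'W uv'; apply/esym/only.
have [c altc c0] : exists2 c, alternating loop_edge (leaps Phi d) c & c != [::].
  apply: (@matching_alternating _ _ _ W m n w (@loop_edge_sym _ _) wW) => u uW.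
    have [muW + only] := mP u uW; rewrite edgeE eq_sym => /andP[ne eu]; split=> // v vW vu uv.
    by apply: only => //; rewrite edgeE eq_sym vu.
  have [nuW lu only] := nP u uW; split=> //; first exact: leapsP.
    by apply/eqP=> nu; have := leapsP _ _ lu; rewrite nu leaps_irr.
  by have [_ _ onlyn] := nP _ nuW; apply/esym/onlyn => //; apply: leap_sym.
by rewrite (acy c altc) in c0.
Qed.

End Fonet.

Unset Implicit Arguments.

Theorem theorem8p2 (Sg : signature) (A : formula Sg) (Phi : derivation ftrue A) :
  rectified_derivation Phi -> false_free A ->
  fonet (fonet_of Phi) /\ dualizer (fonet_of Phi) (delta Phi).
Proof.
move=> rPhi /false_free_no_false nf; have dd := delta_dualizes rPhi.
have dualD := dualizes_dualizer dd; split=> //; split; first exact: fonet_of_linked dd.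
  by exists (delta Phi).
by case=> W; apply: fonet_of_matching.
Qed.
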